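(* Let $\{\underline{X}_{t,n}\}_{t\in\mathbb{Z}}$ be a locally stationary array of centred real $p$-dimensional time series ($p$ fixed) satisfying, uniformly in $n$: $0<\lambda_{\inf}\le\lambda_{\sup}<\infty$; $\sup_t\sum_{j\ne0}|j|^K\|{\bf D}_{t,t+j}\|_\infty<\infty$ for some $K\ge3/2$; and the local stationarity condition (LS) on $\{{\bf D}_{t,\tau}\}$ given in the context, with limiting matrix functions ${\bf D}_j(\cdot)$. Let $\Gamma^{(a,b)}(u;\omega)=\sum_{j\in\mathbb{Z}}[{\bf D}_j(u)]_{a,b}\exp(-ij\omega)$ and $K_r^{(a,b)}(\omega)=\int_0^1\exp(-2\pi iru)\Gamma^{(a,b)}(u;\omega)du$. Then for all $1\le a,b\le p$ and $1\le k_1,k_2\le n$, with $\omega_k=2\pi k/n$, $$[{\bf K}_n(\omega_{k_1},\omega_{k_2})]_{a,b}=\frac1n\sum_{t=1}^n\exp\left(-\frac{i2\pi(k_1-k_2)t}{n}\right)\Gamma^{(a,b)}\left(\frac tn;\omega_{k_2}\right)+O\left(\frac1n\right).$$ Further, $$[{\bf K}_n(\omega_{k_1},\omega_{k_2})]_{a,b}=\begin{cases}K^{(a,b)}_{k_1-k_2}(\omega_{k_2})+O(1/n)&\text{if }|k_1-k_2|\le n/2\\ K^{(a,b)}_{k_1-k_2-n}(\omega_{k_2})+O(1/n)&\text{if }n/2<k_1-k_2<n\\ K^{(a,b)}_{k_1-k_2+n}(\omega_{k_2})+O(1/n)&\text{if }-n<k_1-k_2<-n/2,\end{cases}$$ where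 the $O(n^{-1})$ bounds are uniform over $k_1,k_2$. Moreover, in the last display the leading terms can be replaced by $K^{(b,a)}_{k_2-k_1}(\omega_{k_1})^*$, $K^{(b,a)}_{k_2-k_1+n}(\omega_{k_1})^*$ and $K^{(b,a)}_{k_2-k_1-n}(\omega_{k_1})^*$ respectively ($^*$ = complex conjugate).
   Context: Fix $p\ge1$. For each $n$, $\{\underline{X}_{t}\}_{t\in\mathbb{Z}}=\{\underline{X}_{t,n}\}_{t\in\mathbb{Z}}$, $\underline{X}_t=(X_t^{(1)},\dots,X_t^{(p)})'$, is a real-valued time series with mean zero and finite variances (dependence on $n$ suppressed below); ${\bf C}_{t,\tau}=\mathrm{Cov}(\underline{X}_t,\underline{X}_\tau)$ is $p\times p$, with $\sup_t\|{\bf C}_{t,t}\|_\infty<\infty$ ($\|\cdot\|_\infty$ = largest absolute entry). $\ell_2$ is the Hilbert space of square-summable complex sequences indexed by $\mathbb{Z}$, and $\ell_{2,p}$ the Hilbert space of $v=\mathrm{vec}[u^{(1)},\dots,u^{(p)}]$ with $u^{(s)}\in\ell_2$, with inner product the sum of the $\ell_2$ inner products. $C=(C_{a,b})$ is the infinite block matrix with $[C_{a,b}]_{t,\tau}=[{\bf C}_{t,\tau}]_{a,b}$, acting on $\ell_{2,p}$; $\lambda_{\sup}=\sup_{\|v\|_2=1}\langle v,Cv\rangle$, $\lambda_{\inf}=\inf_{\|v\|_2=1}\langle v,Cv\rangle$ over $v\in\ell_{2,p}$. ''Uniformly in $n$'' means that positive lower and finite upper bounds in the hypotheses can be chosen independent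 of $n$. $\mathcal{H}$ is the closed linear span (in the $L^2$ space with inner product $\mathrm{Cov}$) of all $X_t^{(c)}$; $P_{\mathcal{M}}$ is the orthogonal projection onto a closed subspace $\mathcal{M}$; $\mathcal{H}-X_t^{(a)}$ is the closed span of all $X_s^{(c)}$ with $(s,c)\ne(t,a)$. There are unique coefficients with $P_{\mathcal{H}-X_t^{(a)}}(X_t^{(a)})=\sum_{\tau\in\mathbb{Z}}\sum_{b=1}^p\beta_{(\tau,b)\to(t,a)}X_\tau^{(b)}$, $\beta_{(t,a)\to(t,a)}=0$; put $\sigma_{a,t}^2=\mathrm{E}[X_t^{(a)}-P_{\mathcal{H}-X_t^{(a)}}(X_t^{(a)})]^2$. The inverse covariances are the $p\times p$ matrices ${\bf D}_{t,\tau}$ with $[{\bf D}_{t,\tau}]_{a,b}=1/\sigma_{a,t}^2$ if $(a,t)=(b,\tau)$, and $=-\beta_{(\tau,b)\to(t,a)}/\sigma^2_{a,t}$ otherwise. Condition (LS): there exist a positive sequence $\{\ell(j)\}_{j\in\mathbb{Z}}$ with $\sum_{j\in\mathbb{Z}}|j|\ell(j)^{-1}<\infty$ and matrix functions ${\bf D}_j:\mathbb{R}\to\mathbb{R}^{p\times p}$, $j\in\mathbb{Z}$, such that ${\bf D}_{t,\tau}={\bf D}_{t-\tau}\left(\frac{t+\tau}{2n}\right)+O\left(\frac1{n\ell(t-\tau)}\right)$ uniformly in $t,\tau\in\mathbb{Z}$ (and $n$); and (i) $\sup_u\sum_j\|j{\bf D}_j(u)\|_1<\infty$; (ii) the entrywise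 derivatives exist with $\sup_u\left|\frac{d[{\bf D}_j(u)]_{a,b}}{du}\right|\le\ell(j)^{-1}$; (iii) $\|{\bf D}_j(u)-{\bf D}_j(v)\|_1\le|u-v|\ell(j)^{-1}$ for all $u,v\in\mathbb{R}$. Here $\|\cdot\|_1$ is the sum of absolute values of entries. Finite sample objects: ${\bf X}_n=(X_1^{(1)},\dots,X_n^{(1)},\dots,X_1^{(p)},\dots,X_n^{(p)})'$, $C_n=\mathrm{Var}[{\bf X}_n]$. $F_n$ is the $np\times np$ block-diagonal matrix with $p$ diagonal blocks equal to the $n\times n$ unitary DFT matrix $\mathcal{F}_n$, where $[\mathcal{F}_n^*\underline{x}]_k=\frac1{\sqrt n}\sum_{t=1}^nx_t\exp(-it\omega_k)$, $k=1,\dots,n$. ${\bf K}_n=[\mathrm{Var}(F_n^*{\bf X}_n)]^{-1}=F_n^*C_n^{-1}F_n$ (with $\mathrm{Var}(Z)=\mathrm{E}[ZZ^*]$); $[{\bf K}_n(\omega_{k_1},\omega_{k_2})]_{a,b}$ is the $(k_1,k_2)$ entry of the $(a,b)$-th $n\times n$ block of ${\bf K}_n$. *)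

(* Defs.v *)
From HB Require Import structures.
From mathcomp Require Import all_boot all_order all_algebra.
From mathcomp Require Import complex.
From mathcomp Require Import all_classical all_reals all_analysis.

Set Implicit Arguments.
Unset Strict Implicit.
Unset Printing Implicit Defensive.

Import Order.TTheory GRing.Theory Num.Theory.
Import numFieldNormedType.Exports.

Local Open Scope classical_set_scope.
Local Open Scope complex_scope.
Local Open Scope sesquilinear_scope.
Local Open Scope ring_scope.

Section ComplexAnalysis.
Variable R : realType.

Definition expi (x : R) : R[i] := cos x +i* sin x.

(* Bilateral series are limits of the symmetric partial sums over [-N, N];
   this agrees with the unordered sum whenever the latter converges. *)
Definition zpsum (V : nmodType) (f : int -> V) (N : nat) : V :=
  \sum_(i < N.*2.+1) f (i%:Z - N%:Z).

Definition zsum (f : int -> R) : R := limn (zpsum f).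

Definition czsum (f : int -> R[i]) : R[i] :=
  zsum (fun j => complex.Re (f j)) +i* zsum (fun j => complex.Im (f j)).

Definition cintegral (A : set R) (f : R -> R[i]) : R[i] :=
  (\int[lebesgue_measure]_(u in A) complex.Re (f u))%R
  +i* (\int[lebesgue_measure]_(u in A) complex.Im (f u))%R.

Definition cexpect d (T : measurableType d) (P : probability T R)
    (Z : T -> R[i]) : R[i] :=
  fine ('E_P[fun w => complex.Re (Z w)])%E
  +i* fine ('E_P[fun w => complex.Im (Z w)])%E.

Definition mxnorm1 m n (A : 'M[R]_(m, n)) : R := \sum_i \sum_j `|A i j|.

End ComplexAnalysis.

Section Operator.
Variables (R : realType) (p : nat).

(* An element vec[u^(1), ..., u^(p)] of l_{2,p} is the family v with
   v a t = u^(a)_t; C t tau is the p x p matrix whose (a, b) entry is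
   the (t, tau) entry of the block C_{a,b}. *)
Definition sqsum (v : 'I_p -> int -> R[i]) : \bar R :=
  \sum_(a < p) \esum_(t in [set: int]) ((complex.Re `|v a t|) ^+ 2)%:E.

Definition in_l2p (v : 'I_p -> int -> R[i]) : Prop := (sqsum v < +oo)%E.

Definition dot_l2p (u v : 'I_p -> int -> R[i]) : R[i] :=
  \sum_(a < p) czsum (fun t => (u a t)^* * v a t).

Definition opC (C : int -> int -> 'M[R]_p) (v : 'I_p -> int -> R[i]) :
    'I_p -> int -> R[i] :=
  fun a t => \sum_(b < p) czsum (fun tau => (C t tau a b)%:C * v b tau).

(* For symmetric C the form is real, so taking the real part loses nothing.
   Finitely supported v already force a bounded form, hence a bounded operator,
   when lambda_sup is finite and lambda_inf positive: every series below then
   converges, and no junk limit is involved. *)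
Definition quad_values (C : int -> int -> 'M[R]_p) : set (\bar R) :=
  [set (complex.Re (dot_l2p v (opC C v)))%:E
     | v in [set v | in_l2p v /\ sqsum v = 1%E]].

Definition lambda_sup C : \bar R := ereal_sup (quad_values C).
Definition lambda_inf C : \bar R := ereal_inf (quad_values C).

End Operator.

Section Series.
Context (R : realType) (p : nat) d (T : measurableType d) (P : probability T R).
Implicit Types (X : int -> 'I_p -> {RV P >-> R}).

Definition centred_L2 X : Prop :=
  forall t a, (X t a : T -> R) \in Lfun P 2%:E /\ ('E_P[X t a] = 0)%E.

Definition covmx X (t tau : int) : 'M[R]_p :=
  \matrix_(a, b) fine (covariance P (X t a) (X tau b)).

Definition lin_span X (J : set (int * 'I_p)) : set (T -> R) :=
  [set Y | exists (s : seq (int * 'I_p)) (c : int * 'I_p -> R),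
     [set` s] `<=` J /\ Y = (fun w => \sum_(i <- s) c i * X i.1 i.2 w)].

Definition closed_span X (J : set (int * 'I_p)) : set (T -> R) :=
  [set Y | (Y : T -> R) \in Lfun P 2%:E /\
     forall e : R, 0 < e ->
       exists2 L, lin_span X J L & ('N[P]_2%:E[EFin \o (Y \- L)%R] < e%:E)%E].

Definition is_orth_proj (M : set (T -> R)) (x y : T -> R) : Prop :=
  M y /\ forall z, M z -> covariance P (x \- y) z = 0%E.

(* Y is a version of the projection of X_t^(a) on H - X_t^(a). *)
Definition is_best_predictor X t a (Y : T -> R) : Prop :=
  is_orth_proj (closed_span X [set i | i <> (t, a)]) (X t a) Y.

(* beta s c stands for beta_{(s,c) -> (t,a)}; the series converges in L^2. *)
Definition predictor_coef X (t : int) (a : 'I_p) (Y : T -> R)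
    (beta : int -> 'I_p -> R) : Prop :=
  beta t a = 0 /\
  ('N[P]_2%:E[EFin \o (Y \-
      (fun w => zpsum (fun s => \sum_(c < p) beta s c * X s c w) N))%R])%E
    @[N --> \oo] --> 0%E.

Definition prediction_var X t a (Y : T -> R) : R :=
  fine ('E_P[fun w => ((X t a w - Y w) ^+ 2)%R])%E.

Definition is_inverse_covariance X (D : int -> int -> 'M[R]_p) : Prop :=
  exists (Y : int -> 'I_p -> T -> R) (beta : int -> 'I_p -> int -> 'I_p -> R),
    [/\ forall t a, is_best_predictor X t a (Y t a),
        forall t a, predictor_coef X t a (Y t a) (beta t a) &
        forall t tau, D t tau = \matrix_(a, b)
          let sigma2 := prediction_var X t a (Y t a) in
          if (a, t) == (b, tau) then sigma2^-1
          else - beta t a tau b / sigma2].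

End Series.

Section LocalStationarity.
Variables (R : realType) (p : nat).

Definition locally_stationary (D : nat -> int -> int -> 'M[R]_p)
    (Dlim : int -> R -> 'M[R]_p) : Prop :=
  exists ell : int -> R,
    [/\ forall j, 0 < ell j,
        (\esum_(j in [set: int]) (`|j|%:~R / ell j)%:E < +oo)%E &
        exists M : R, forall n : nat, (0 < n)%N -> forall t tau : int,
          mx_norm (D n t tau - Dlim (t - tau) ((t + tau)%:~R / (2 * n%:R)))
          <= M / (n%:R * ell (t - tau))] /\
    [/\ (ereal_sup (range (fun u : R =>
           \esum_(j in [set: int]) (mxnorm1 (j%:~R *: Dlim j u))%:E)) < +oo)%E,
        forall j u a b, derivable (fun x : R => Dlim j x a b) u 1
          /\ `|derive1 (fun x : R => Dlim j x a b) u| <= (ell j)^-1 &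
        forall j u v, mxnorm1 (Dlim j u - Dlim j v) <= `|u - v| / ell j].

Definition Gamma (Dlim : int -> R -> 'M[R]_p) (a b : 'I_p) (u omega : R) :
    R[i] :=
  czsum (fun j => (Dlim j u a b)%:C * expi (- (j%:~R * omega))).

Definition Kcoef (Dlim : int -> R -> 'M[R]_p) (a b : 'I_p) (r : int)
    (omega : R) : R[i] :=
  cintegral `[0, 1]
    (fun u => expi (- (2 * pi * r%:~R * u)) * Gamma Dlim a b u omega).

End LocalStationarity.

Section FiniteSample.
Context (R : realType) (p : nat) d (T : measurableType d) (P : probability T R).

(* Times and frequencies run over 1, ..., n: i : 'I_n stands for i.+1. *)
Definition omega n (k : 'I_n) : R := 2 * pi * k.+1%:R / n%:R.

Definition dft n : 'M[R[i]]_n :=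
  \matrix_(i, k) (((Num.sqrt n%:R)^-1)%:C * expi (i.+1%:R * omega k)).

Definition dft_block n : 'M[R[i]]_(\sum_(a < p) n) := \mxdiag_(a < p) dft n.

Definition sample n (X : int -> 'I_p -> {RV P >-> R}) (w : T) :
    'cV[R[i]]_(\sum_(a < p) n) :=
  \mxcol_(a < p) \col_(i < n) (X i.+1%:Z a w)%:C.

(* E[Z Z^*], the variance of a centred complex random vector. *)
Definition cvar m (Z : T -> 'cV[R[i]]_m) : 'M[R[i]]_m :=
  \matrix_(k, l) cexpect P (fun w => (Z w *m (Z w)^t*) k l).

Definition Kmx n (X : int -> 'I_p -> {RV P >-> R}) :
    'M[R[i]]_(\sum_(a < p) n) :=
  invmx (cvar (fun w => (dft_block n)^t* *m sample n X w)).

Definition Kentry n (X : int -> 'I_p -> {RV P >-> R}) (a b : 'I_p)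
    (k1 k2 : 'I_n) : R[i] :=
  submxblock (Kmx n X) a b k1 k2.

End FiniteSample.

(* Main.v *)
Require Import Defs.
From HB Require Import structures.
From mathcomp Require Import all_boot all_order all_algebra.
From mathcomp Require Import complex.
From mathcomp Require Import all_classical all_reals all_analysis.
From mathcomp Require Import ring lra zify.

Set Implicit Arguments.
Unset Strict Implicit.
Unset Printing Implicit Defensive.

Import Order.TTheory GRing.Theory Num.Theory.
Import numFieldNormedType.Exports.

Local Open Scope classical_set_scope.
Local Open Scope complex_scope.
Local Open Scope ring_scope.

(** Let W be the window of the indices (t, a) with 1 <= t <= n, let C_n be the
    covariance matrix of the variables indexed by W and D_W the W x W block of
    the inverse covariances.

    The residual of the best linear predictor of X_i, divided by its variance,
    is a dual variable e_i: its covariance with X_j is 1 if i = j and 0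
    otherwise.  Therefore D_ij is at the same time the covariance of e_i and
    e_j and the coefficient of X_j in the L^2 expansion of e_i
    ([inverse_covariance_dual], [dual_dotE]).  For a real vector y on W put
    e(y) = sum_k y_k e_k.  Its projection on the span of the X_k, k in W, has
    the coefficients C_n^-1 y, so that x^T (D_W - C_n^-1) y is the inner product
    of the residuals of the projections of e(x) and e(y)
    ([gram_inverse_residual]).  The residual of e(y) is at most as long as the
    part of the expansion of e(y) that lies outside W, whose variance is at most
    lambda_sup times the sum over s outside 1..n of (sum_{t in W} |D_st|)^2 when
    |y| <= 1.  The inner sum decays like the inverse distance of s to the
    window, so the whole is bounded, uniformly in n
    ([finite_section_inverse]).  Since the discrete Fourier transform is
    unitary, K_n is the transform of C_n^-1, with a factor 1/n; taking cosines
    and sines for x and y, it differs by O(1/n) from the transform of D_W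
    ([Kentry_approx]).

    Local stationarity provides weights w with sum_j (1 + |j|) w(j) finite that
    dominate the functions D_j on [0, 1], their variation and the error of the
    local approximation ([locally_stationary_weights]).  Replacing
    D_{t,tau} by D_{t-tau}(t/n) costs (1 + |t - tau|) w(t - tau) / n, and
    completing the sum over tau to all lags j costs w(j) for each of the at most
    |j| times t that the lag j takes out of the window.  Both totals are bounded,
    which proves the first display ([dft_inverse_covariance]).

    It remains to compare a Riemann sum of exp(-2 pi i r u) Gamma(u) with its
    integral, where the naive error is of order r/n.  Summation by parts moves
    the differences to the Lipschitz factor Gamma and leaves the discrepancies
    of the exponential alone, which are explicit: up to bounded factors and
    terms of order 1/n they are (cot alpha - 1/alpha) / n with
    alpha = pi r / n.  This is O(1/n) exactly because |r| <= n/2 keeps |alpha| <= pi/2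
    ([riemann_sum_cos], [riemann_Gamma]).  Frequencies that differ by n agree on
    the grid, which brings every r into this range, and the last display is the
    second one for the Hermitian transpose of K_n ([Kentry_conj]). *)

(** * Semi-inner products and Gram matrices *)

Section SemiInnerProduct.
Context (R : realType) (V : lmodType R) (ip : V -> V -> R).
Context (ipC : forall f g, ip f g = ip g f)
  (ipDl : forall f g h, ip (f + g) h = ip f h + ip g h)
  (ipZl : forall a f h, ip (a *: f) h = a * ip f h)
  (ip_ge0 : forall f, 0 <= ip f f).

Lemma ip0l h : ip 0 h = 0.
Proof. by rewrite -(scale0r 0) ipZl mul0r. Qed.

Lemma ipBl f g h : ip (f - g) h = ip f h - ip g h.
Proof. by rewrite -scaleN1r ipDl ipZl mulN1r. Qed.

Lemma ipZr a f h : ip h (a *: f) = a * ip h f.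
Proof. by rewrite ipC ipZl ipC. Qed.

Lemma ipDr f g h : ip h (f + g) = ip h f + ip h g.
Proof. by rewrite ipC ipDl !(ipC h). Qed.

Lemma ipBr f g h : ip h (f - g) = ip h f - ip h g.
Proof. by rewrite ipC ipBl !(ipC h). Qed.

Lemma ip_suml (I : Type) (s : seq I) (Q : pred I) (F : I -> V) h :
  ip (\sum_(i <- s | Q i) F i) h = \sum_(i <- s | Q i) ip (F i) h.
Proof.
elim/big_rec2: _ => [|i x y _ <-]; first exact: ip0l.
exact: ipDl.
Qed.

Lemma ip_sumr (I : Type) (s : seq I) (Q : pred I) (F : I -> V) h :
  ip h (\sum_(i <- s | Q i) F i) = \sum_(i <- s | Q i) ip h (F i).
Proof. by rewrite ipC ip_suml; apply: eq_bigr => i _; rewrite ipC. Qed.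

Lemma ip_cauchy_schwarz f g : (ip f g) ^+ 2 <= ip f f * ip g g.
Proof.
(* nonnegativity of the squared length of f - s g *)
have H (s : R) : 0 <= ip f f - 2 * s * ip f g + s ^+ 2 * ip g g.
  have := ip_ge0 (f - s *: g).
  rewrite ipBl !ipBr !ipZl !ipZr (ipC g f) => /le_trans; apply.
  by rewrite le_eqVlt; apply/orP; left; apply/eqP; ring.
have [g0|gn0] := eqVneq (ip g g) 0.
  have [->|fgn0] := eqVneq (ip f g) 0; first by rewrite expr0n/= g0 mulr0.
  (* a linear function of s is nonnegative only if it is constant *)
  have := H ((ip f f + 1) / (2 * ip f g)); rewrite g0 mulr0 addr0.
  have -> : 2 * ((ip f f + 1) / (2 * ip f g)) * ip f g = ip f f + 1 by field.
  lra.
have g_gt0 : 0 < ip g g by rewrite lt_def gn0 ip_ge0.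
have := H (ip f g / ip g g).
have -> : ip f f - 2 * (ip f g / ip g g) * ip f g +
   (ip f g / ip g g) ^+ 2 * ip g g = (ip f f * ip g g - (ip f g) ^+ 2) / ip g g.
  by field.
by rewrite pmulr_lge0 ?invr_gt0// subr_ge0.
Qed.

Lemma ip_normD_le f g : ip (f + g) (f + g) <= 2 * ip f f + 2 * ip g g.
Proof.
have := ip_ge0 (f - g); rewrite ipBl !ipBr ipDl !ipDr (ipC g f); lra.
Qed.

(** Convergence in the seminorm, so that the expansion of a dual variable can be
    paired term by term with a fixed vector. *)
Lemma ip_cvgl (F : nat -> V) f h :
  ip (f - F N) (f - F N) @[N --> \oo] --> 0 ->
  ip (F N) h @[N --> \oo] --> ip f h.
Proof.
move=> F0; apply/subr_cvg0.
apply/norm_cvg0P.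
have : Num.sqrt (ip (f - F N) (f - F N) * ip h h) @[N --> \oo] --> 0.
  rewrite -[X in _ --> X]sqrtr0 -(mul0r (ip h h)).
  apply: (@continuous_cvg _ _ _ _ _ (fun N => ip (f - F N) (f - F N) * ip h h)).
    exact: sqrt_continuous.
  by apply: cvgM F0 _; exact: cvg_cst.
apply: squeeze_cvgr (@cvg_cst _ 0 _ _ _).
apply: nearW => N; rewrite normr_ge0/= -ipBl.
rewrite -sqrtr_sqr ler_wsqrtr// (le_trans _ (ip_cauchy_schwarz _ _))//.
by rewrite -[F N - f]opprB -(scaleN1r (f - F N)) ipZl mulN1r sqrrN.
Qed.

(** With r(x) the residual of the projection of sum_k x_k e_k on the span of the
    X_k, the bilinear form is the inner product of r(x) and r(y): the projection
    has coefficients G^-1 x by duality.  A residual is no longer than the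
    distance to any element of the span, and |<f, g>| is at most the maximum of
    the two squared lengths. *)
Lemma gram_inverse_residual m (X e : 'I_m -> V) (G : 'M[R]_m)
    (x y u v : 'I_m -> R) (B : R) :
  (forall k l, G k l = ip (X k) (X l)) -> G \in unitmx ->
  (forall k l, ip (e k) (X l) = (k == l)%:R) ->
  (let f := \sum_k x k *: e k - \sum_k u k *: X k in ip f f <= B) ->
  (let f := \sum_k y k *: e k - \sum_k v k *: X k in ip f f <= B) ->
  `|\sum_k \sum_l x k * (ip (e k) (e l) - invmx G k l) * y l| <= B.
Proof.
move=> GE Gu eX.
pose pr z := \sum_k (\sum_l invmx G k l * z l) *: X k.
pose E z := \sum_k z k *: e k.
pose r z := E z - pr z.
have eXs z l : ip (E z) (X l) = z l.
  rewrite ip_suml (bigD1 l)//= ipZl eX eqxx mulr1 big1 ?addr0// => k kl.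
  by rewrite ipZl eX (negPf kl) mulr0.
have prX z l : ip (pr z) (X l) = z l.
  rewrite ip_suml.
  under eq_bigr do rewrite ipZl -GE mulr_suml.
  rewrite exchange_big/=.
  under eq_bigr do (under eq_bigr do rewrite mulrAC (mulrC _ (G _ _))).
  have Gs : G^T = G by apply/matrixP => i j; rewrite mxE !GE ipC.
  have H i : \sum_j G j l * invmx G j i = (i == l)%:R.
    have := mulmxV Gu => /matrixP /(_ l i); rewrite !mxE eq_sym => <-.
    by apply: eq_bigr => j _; rewrite -{1}Gs mxE.
  under eq_bigr do rewrite -mulr_suml H.
  rewrite (bigD1 l)//= eqxx mul1r big1 ?addr0// => k kl.
  by rewrite (negPf kl) mul0r.
have rX z l : ip (r z) (X l) = 0 by rewrite ipBl eXs prX subrr.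
have rcX z w : ip (r z) (\sum_k w k *: X k) = 0.
  by rewrite ip_sumr big1// => k _; rewrite ipZr rX mulr0.
have rB z w : ip (E z - \sum_k w k *: X k) (E z - \sum_k w k *: X k) <= B ->
    ip (r z) (r z) <= B.
  apply: le_trans.
  have -> : E z - \sum_k w k *: X k =
      r z + \sum_k ((\sum_l invmx G k l * z l) - w k) *: X k.
    rewrite /r /pr; under [X in _ = _ + X]eq_bigr do rewrite scalerBl.
    by rewrite sumrB -addrA; congr (_ + _); rewrite addKr.
  have := rcX z (fun k => (\sum_l invmx G k l * z l) - w k).
  move: (\sum_k _ *: X k) (r z) => S q qS.
  by rewrite ipDl !ipDr (ipC S q) qS addr0 add0r lerDl ip_ge0.
move=> /rB xB /rB yB.
have -> : \sum_k \sum_l x k * (ip (e k) (e l) - invmx G k l) * y l =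
    ip (r x) (r y).
  rewrite {2}/r ipBr rcX subr0 ipBl.
  under eq_bigr do (under eq_bigr do rewrite mulrBr mulrBl; rewrite sumrB).
  rewrite sumrB; congr (_ - _).
    rewrite ip_suml; apply: eq_bigr => k _; rewrite ipZl ip_sumr mulr_sumr.
    by apply: eq_bigr => l _; rewrite ipZr; ring.
  rewrite (ipC (pr x)) ip_sumr.
  under [RHS]eq_bigr do rewrite ipZr eXs mulr_suml.
  rewrite exchange_big/=; apply: eq_bigr => k _; apply: eq_bigr => l _.
  have Gs : (invmx G)^T = invmx G.
    by rewrite trmx_inv; congr invmx; apply/matrixP => i j; rewrite mxE !GE ipC.
  by rewrite -{1}Gs mxE; ring.
move: (r x) (r y) xB yB => f g fB gB.
have := ip_ge0 (f - g); have := ip_ge0 (f + g).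
rewrite ipBl !ipBr ipDl !ipDr (ipC g f) ler_norml => H1 H2.
apply/andP; split; lra.
Qed.

End SemiInnerProduct.

(** * Square-integrable random variables *)

Section SquareIntegrable.
Context (R : realType) d (T : measurableType d) (P : probability T R).

Definition L2 := LfunType P (lee1n 2 : (1 <= 2%:E :> \bar R)%E).
(** Random variables are kept as functions rather than as classes modulo null
    sets, so this inner product is only positive semidefinite. *)
Definition dotE (f g : L2) : R := fine ('E_P[(f : T -> R) \* g]).

Lemma L2_mul_Lfun1 (f g : L2) : (f : T -> R) \* g \in Lfun P 1.
Proof. by apply: Lfun2_mul_Lfun1; exact: LfunP. Qed.

Lemma dotEC f g : dotE f g = dotE g f.
Proof. by rewrite /dotE; congr (fine 'E_P[_]); apply/funext => w /=; rewrite mulrC. Qed.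

Lemma dotEDl f g h : dotE (f + g) h = dotE f h + dotE g h.
Proof.
rewrite /dotE -fineD ?expectation_fin_num ?L2_mul_Lfun1//.
rewrite -expectationD ?L2_mul_Lfun1//.
by congr (fine 'E_P[_]); apply/funext => w /=; rewrite -mulrDl.
Qed.

Lemma dotEZl a f h : dotE (a *: f) h = a * dotE f h.
Proof.
rewrite /dotE -[a in RHS]/(fine a%:E) -fineM ?expectation_fin_num ?L2_mul_Lfun1//.
rewrite -expectationZl ?L2_mul_Lfun1//.
congr (fine 'E_P[_]); apply/funext => w /=.
by rewrite [RHS]mulrC mulrA.
Qed.

Lemma dotE_ge0 f : 0 <= dotE f f.
Proof. by apply/fine_ge0/expectation_ge0 => w /=; rewrite -expr2 sqr_ge0. Qed.

Lemma dotE_Lnorm (f : L2) : ('N[P]_2%:E[EFin \o (f : T -> R)] = (Num.sqrt (dotE f f))%:E)%E.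
Proof.
have : ('N[P]_2%:E[EFin \o f] `^ 2 = (dotE f f)%:E)%E.
  rewrite powR_Lnorm//.
  rewrite /dotE fineK ?expectation_fin_num ?L2_mul_Lfun1// unlock.
  apply: eq_integral => w _ /=.
  by rewrite powR_mulrn// real_normK ?num_real.
have := Lnorm_ge0 P 2%:E (EFin \o f : T -> \bar R).
case: ('N[P]_2%:E[EFin \o f])%E => [r| |]//.
  rewrite lee_fin => r0 [] /=.
  by rewrite powR_mulrn// => <-; rewrite sqrtr_sqr ger0_norm.
by move=> _; rewrite poweRyr.
Qed.

End SquareIntegrable.

(** * Symmetric bilateral sums *)

Section SymmetricSums.

(** The summation range of [zpsum] as a duplicate-free sequence, so that
    symmetric sums can be compared with sums over other index sets. *)
Definition zrange (N : nat) : seq int :=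
  [seq i%:Z - N%:Z | i <- iota 0 N.*2.+1].

Lemma zrange_uniq N : uniq (zrange N).
Proof. by rewrite map_inj_uniq ?iota_uniq// => i j; lia. Qed.

Lemma mem_zrange N (s : int) : (s \in zrange N) = (`|s|%N <= N)%N.
Proof.
apply/mapP/idP => [[k] | sN].
  by rewrite mem_iota => /andP[_ kN] ->; lia.
exists (absz (s + N%:Z)); last lia.
by rewrite mem_iota; lia.
Qed.

Lemma zpsumE (V : nmodType) (f : int -> V) N :
  zpsum f N = \sum_(s <- zrange N) f s.
Proof.
by rewrite /zpsum big_map -[iota _ _]/(index_iota 0 N.*2.+1) big_mkord.
Qed.

(** The device by which all re-indexings of symmetric sums are made: two
    duplicate-free enumerations give the same sum once they agree on the
    support. *)
Lemma big_uniq_supp (V : nmodType) (I : eqType) (r1 r2 : seq I) (f : I -> V) :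
  uniq r1 -> uniq r2 -> {subset r2 <= r1} ->
  (forall i, i \in r1 -> i \notin r2 -> f i = 0) ->
  \sum_(i <- r1) f i = \sum_(i <- r2) f i.
Proof.
move=> u1 u2 s21 f0; rewrite (bigID (mem r2))/= [X in _ + X]big_seq_cond.
rewrite [X in _ + X]big1 ?addr0; last by move=> i /andP[]; exact: f0.
rewrite -big_filter; apply: perm_big.
apply: uniq_perm; rewrite ?filter_uniq// => i.
by rewrite mem_filter; case: (boolP (i \in r2)) => //= /s21.
Qed.

Lemma zpsum_widen (V : nmodType) (f : int -> V) N M : (N <= M)%N ->
  (forall s, (N < `|s|)%N -> f s = 0) -> zpsum f M = zpsum f N.
Proof.
move=> NM f0; rewrite !zpsumE; apply: big_uniq_supp; rewrite ?zrange_uniq//.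
  by move=> s; rewrite !mem_zrange => /leq_trans; apply.
by move=> s _; rewrite mem_zrange -ltnNge => /f0.
Qed.

Lemma zsum_fin (R : realType) (f : int -> R) N :
  (forall s, (N < `|s|)%N -> f s = 0) -> zsum f = zpsum f N.
Proof.
move=> f0; apply: cvg_lim => //.
apply: cvg_near_cst; exists N => // M /= NM.
exact: zpsum_widen.
Qed.

Lemma czsum_fin (R : realType) (f : int -> R) N :
  (forall s, (N < `|s|)%N -> f s = 0) ->
  czsum (fun s => (f s)%:C) = (zpsum f N)%:C.
Proof.
move=> f0; rewrite /czsum/= (zsum_fin f0); congr (_ +i* _).
by rewrite (@zsum_fin _ _ 0)// /zpsum big1.
Qed.

Lemma esum_fin (R : realType) (f : int -> R) N : (forall s, 0 <= f s) ->
  (forall s, (N < `|s|)%N -> f s = 0) ->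
  (\esum_(s in [set: int]) (f s)%:E)%E = (zpsum f N)%:E.
Proof.
move=> f0 fN.
pose A : set int := [set` zrange N].
have -> : (\esum_(s in [set: int]) (f s)%:E = \esum_(s in A) (f s)%:E)%E.
  rewrite [RHS]esum_mkcond; apply: eq_esum => s _.
  case: ifPn => // /negP; rewrite inE /A/= mem_zrange => /negP.
  by rewrite -ltnNge => /fN ->.
rewrite esum_fset; [|exact: finite_seq|by move=> s _; rewrite lee_fin].
by rewrite -fsbig_seq ?zrange_uniq// sumEFin zpsumE.
Qed.

End SymmetricSums.

(** * The covariance operator on finite linear combinations *)

Section Process.
Context (R : realType) (p : nat) d (T : measurableType d) (P : probability T R).
Context (X : int -> 'I_p -> {RV P >-> R}) (hX : centred_L2 X).

Definition vX t a : L2 P := Lfun_Sub _ (hX t a).1.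

(** Only one argument has to be centred for the covariance to be an inner
    product, so the predictors, whose means are not assumed to vanish, are
    covered. *)
Lemma covariance_vX (f : L2 P) t a :
  covariance P f (X t a) = (dotE f (vX t a))%:E.
Proof.
have L21 (g : L2 P) : (g : T -> R) \in Lfun P 1.
  by apply: Lfun_subset12; [exact: fin_num_measure|exact: LfunP].
rewrite covarianceE.
- by rewrite (hX t a).2 mule0 sube0 /dotE fineK ?expectation_fin_num ?L2_mul_Lfun1.
- exact: L21.
- exact: (L21 (vX t a)).
- exact: (L2_mul_Lfun1 f (vX t a)).
Qed.

Lemma covmxE t tau a b : covmx X t tau a b = dotE (vX t a) (vX tau b).
Proof. by rewrite mxE -[X t a : T -> R]/(vX t a : T -> R) covariance_vX. Qed.

Definition lincomb (c : int -> 'I_p -> R) N : L2 P :=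
  zpsum (fun s => \sum_a c s a *: vX s a) N.

Lemma dotE_lincomb (c : int -> 'I_p -> R) N (f : L2 P) :
  dotE f (lincomb c N) = zpsum (fun s => \sum_a c s a * dotE f (vX s a)) N.
Proof.
have C := @dotEC R d T P; have Dl := @dotEDl R d T P; have Zl := @dotEZl R d T P.
rewrite (ip_sumr C Dl Zl); apply: eq_bigr => s _.
by rewrite (ip_sumr C Dl Zl); apply: eq_bigr => a _; rewrite (ipZr C Zl).
Qed.

(** The variance of a finite linear combination is a value of the quadratic form
    of the infinite covariance matrix at a finitely supported unit vector; every
    series in the definition of the form is then a finite sum. *)
Lemma quad_form_lincomb (c : int -> 'I_p -> R) N :
  (forall s a, (N < `|s|)%N -> c s a = 0) ->
  zpsum (fun s => \sum_a c s a ^+ 2) N = 1 ->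
  quad_values (covmx X) (dotE (lincomb c N) (lincomb c N))%:E.
Proof.
move=> c0 c1; exists (fun a s => (c s a)%:C).
  have sE : sqsum (fun a s => (c s a)%:C) = 1%E.
    rewrite /sqsum -[1%E]/(1%R%:E) -c1 /zpsum exchange_big/= -sumEFin.
    apply: eq_bigr => a _.
    have -> : (\esum_(t in [set: int]) (complex.Re `|(c t a)%:C| ^+ 2)%:E =
      \esum_(t in [set: int]) (c t a ^+ 2)%:E)%E.
      apply: eq_esum => t _; rewrite normc_def/= expr0n/= addr0 sqr_sqrtr ?sqr_ge0//.
    by rewrite (@esum_fin _ _ N)// => [s|s /c0 ->]; rewrite ?sqr_ge0 ?expr0n.
  by split => //; rewrite /in_l2p sE ltry.
have opE a t : opC (covmx X) (fun a s => (c s a)%:C) a t =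
    (dotE (vX t a) (lincomb c N))%:C.
  rewrite dotE_lincomb /zpsum exchange_big/= rmorph_sum/=.
  apply: eq_bigr => b _.
  rewrite -(@czsum_fin _ (fun s => c s b * dotE (vX t a) (vX s b)) N).
    by congr czsum; apply/funext => s; rewrite -rmorphM/= covmxE mulrC.
  by move=> s /c0 ->; rewrite mul0r.
rewrite /dot_l2p.
under eq_bigr => a _.
  rewrite (_ : (fun _ => _) =
      fun t => (c t a * dotE (lincomb c N) (vX t a))%:C); last first.
    apply/funext => t; rewrite opE dotEC rmorphM/=; congr (_ * _).
    exact: conjc_real.
  rewrite (@czsum_fin _ _ N); last by move=> s /c0 ->; rewrite mul0r.
  over.
rewrite dotE_lincomb /zpsum exchange_big/= -rmorph_sum/=.
by [].
Qed.

Context (lo hi : R).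
Context (hlo : (lo%:E <= lambda_inf (covmx X))%E)
  (hhi : (lambda_sup (covmx X) <= hi%:E)%E).

(** The only way in which the spectral bounds are used: rescale the coefficients
    to a unit vector. *)
Lemma dotE_lincomb_bounds (c : int -> 'I_p -> R) N :
  let S := zpsum (fun s => \sum_a c s a ^+ 2) N in
  lo * S <= dotE (lincomb c N) (lincomb c N) <= hi * S.
Proof.
set S := zpsum _ N; rewrite /=.
have S0 : 0 <= S by rewrite sumr_ge0// => i _; rewrite sumr_ge0// => a _; rewrite sqr_ge0.
have [S_eq0|Sn0] := eqVneq S 0.
  have c0 s a : s \in zrange N -> c s a = 0.
    move=> sN; have := S_eq0; rewrite /S zpsumE.
    move/eqP; rewrite psumr_eq0; last by move=> *; rewrite sumr_ge0// => ? _; rewrite sqr_ge0.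
    move=> /allP /(_ _ sN)/=; rewrite psumr_eq0; last by move=> *; rewrite sqr_ge0.
    by move=> /allP /(_ a (mem_index_enum _)); rewrite sqrf_eq0 => /eqP.
  have -> : lincomb c N = 0.
    rewrite /lincomb zpsumE big_seq big1// => s sN.
    by rewrite big1// => a _; rewrite c0// scale0r.
  by rewrite S_eq0 !mulr0 (ip0l (@dotEZl R d T P)) lexx.
have S_gt0 : 0 < S by rewrite lt_def Sn0.
(* outside the range of summation the coefficients do not matter, but the
   vector of the quadratic form must vanish there *)
pose c' s a := if (`|s| <= N)%N then c s a / Num.sqrt S else 0.
have c'E s a : s \in zrange N -> c' s a = c s a / Num.sqrt S.
  by rewrite mem_zrange /c' => ->.
have lE : lincomb c' N = (Num.sqrt S)^-1 *: lincomb c N.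
  rewrite /lincomb !zpsumE scaler_sumr big_seq [RHS]big_seq.
  apply: eq_bigr => s sN; rewrite scaler_sumr; apply: eq_bigr => a _.
  by rewrite c'E// scalerA mulrC.
have qv : quad_values (covmx X) (dotE (lincomb c' N) (lincomb c' N))%:E.
  apply: quad_form_lincomb.
    by move=> s a; rewrite /c' ltnNge => /negPf ->.
  rewrite zpsumE big_seq.
  transitivity (\sum_(s <- zrange N | s \in zrange N) S^-1 * \sum_a c s a ^+ 2).
    apply: eq_bigr => s sN; rewrite mulr_sumr; apply: eq_bigr => a _.
    by rewrite c'E// exprMn exprVn sqr_sqrtr// mulrC.
  by rewrite -big_seq -mulr_sumr -zpsumE mulVf.
have Zl := @dotEZl R d T P; have C := @dotEC R d T P.
move: qv; rewrite lE Zl (ipZr C Zl) mulrA -invfM -expr2 sqr_sqrtr// => qv.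
apply/andP; split.
  have : (lo%:E <= (S^-1 * dotE (lincomb c N) (lincomb c N))%:E)%E.
    by apply: le_trans hlo _; apply: ereal_inf_lbound.
  by rewrite lee_fin mulrC ler_pdivlMr.
have : ((S^-1 * dotE (lincomb c N) (lincomb c N))%:E <= hi%:E)%E.
  by apply: le_trans hhi; apply: ereal_sup_ubound.
by rewrite lee_fin mulrC ler_pdivrMr.
Qed.

End Process.

(** * The dual variables of the inverse covariance *)

Section InverseCovariance.
Context (R : realType) (p : nat) d (T : measurableType d) (P : probability T R).
Context (X : int -> 'I_p -> {RV P >-> R}) (hX : centred_L2 X).
Context (lo hi : R) (lo_gt0 : 0 < lo).
Context (hlo : (lo%:E <= lambda_inf (covmx X))%E)
  (hhi : (lambda_sup (covmx X) <= hi%:E)%E).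
Local Notation vX := (vX hX).
Local Notation lincomb := (lincomb hX).
Let C := @dotEC R d T P.
Let Dl := @dotEDl R d T P.
Let Zl := @dotEZl R d T P.

Lemma lincombE c N w :
  (lincomb c N : T -> R) w = zpsum (fun s => \sum_a c s a * X s a w) N.
Proof.
pose ev (f : L2 P) := (f : T -> R) w.
have evD : {morph ev : f g / f + g} by [].
rewrite -[LHS]/(ev _) /lincomb /zpsum (big_morph ev evD (erefl : ev 0 = 0)).
by apply: eq_bigr => s _; rewrite (big_morph ev evD (erefl : ev 0 = 0)).
Qed.

Lemma lincombZB k c c' N :
  lincomb (fun s a => k * (c s a - c' s a)) N = k *: (lincomb c N - lincomb c' N).
Proof.
rewrite /lincomb /zpsum -sumrB scaler_sumr; apply: eq_bigr => s _.
rewrite -sumrB scaler_sumr; apply: eq_bigr => a _.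
by rewrite -scalerBl scalerA.
Qed.

Lemma zpsum_delta (V : nmodType) (f : int -> 'I_p -> V) t a N : (`|t| <= N)%N ->
  zpsum (fun s => \sum_b (if (s, b) == (t, a) then f s b else 0)) N = f t a.
Proof.
rewrite -mem_zrange zpsumE => tN.
rewrite (bigD1_seq t) ?zrange_uniq//= (bigD1 a)//= eqxx.
rewrite big1 ?addr0; last first.
  by move=> b /negPf ba; rewrite xpair_eqE ba andbF.
rewrite big1 ?addr0// => s /negPf st.
by rewrite big1// => b _; rewrite xpair_eqE st.
Qed.

Lemma lincomb_delta t a N : (`|t| <= N)%N ->
  lincomb (fun s b => ((s, b) == (t, a))%:R) N = vX t a.
Proof.
move=> tN; rewrite -(zpsum_delta vX a tN); apply: eq_bigr => s _.
by apply: eq_bigr => b _; case: ifP => _; rewrite ?scale1r ?scale0r.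
Qed.

Lemma mem_closed_span (J : set (int * 'I_p)) s b : J (s, b) ->
  closed_span X J (X s b).
Proof.
move=> Jsb; split; first exact: (hX s b).1.
move=> e e0; exists (X s b : T -> R).
  exists [:: (s, b)], (fun=> 1); split; first by move=> i /=; rewrite inE => /eqP ->.
  by apply/funext => w; rewrite big_seq1 mul1r.
have -> : EFin \o (X s b \- X s b)%R = EFin \o ((0%R : L2 P) : T -> R).
  by apply/funext => w /=; rewrite subrr.
by rewrite dotE_Lnorm (ip0l Zl) sqrtr0 lte_fin.
Qed.

Lemma Lnorm_cvg0 (F : nat -> L2 P) :
  ('N[P]_2%:E[EFin \o (F N : T -> R)])%E @[N --> \oo] --> 0%E ->
  dotE (F N) (F N) @[N --> \oo] --> 0.
Proof.
under eq_fun do rewrite dotE_Lnorm.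
move=> /fine_cvgP[_] /= F0.
have -> : (fun N => dotE (F N) (F N)) =
    (fun N => Num.sqrt (dotE (F N) (F N)) * Num.sqrt (dotE (F N) (F N))).
  by apply/funext => N; rewrite -expr2 sqr_sqrtr// dotE_ge0.
by rewrite -(mulr0 0); apply: cvgM.
Qed.

(** The residual is orthogonal to all variables but X_t^(a), hence to the partial
    sums of the predictor and to their limit.  It does not vanish: it is the
    limit of linear combinations in which X_t^(a) has coefficient 1, whose
    variances are at least [lo]. *)
Lemma best_predictor_residual t a (Y : T -> R) beta :
  is_best_predictor X t a Y -> predictor_coef X t a Y beta ->
  exists res : L2 P,
    [/\ dotE res res = prediction_var X t a Y,
        0 < dotE res res,
        forall s b, dotE res (vX s b) = dotE res res *+ ((s, b) == (t, a)) &
        (let f N := res - (vX t a - lincomb beta N) in dotE (f N) (f N))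
          @[N --> \oo] --> 0].
Proof.
move=> [[Y2 _] Yorth] [beta0 Ycvg].
pose y : L2 P := Lfun_Sub _ Y2.
pose res : L2 P := vX t a - y; exists res.
have resX s b : (s, b) <> (t, a) -> dotE res (vX s b) = 0.
  move=> sb; apply: EFin_inj; rewrite -(covariance_vX hX).
  by apply: Yorth; apply: mem_closed_span.
have ycvg : dotE (y - lincomb beta N) (y - lincomb beta N) @[N --> \oo] --> 0.
  apply: Lnorm_cvg0; move: Ycvg.
  under eq_fun => N.
    rewrite (_ : (EFin \o _)%E = EFin \o ((y - lincomb beta N : L2 P) : T -> R)); last first.
      by apply/funext => w /=; congr ((_ - _)%:E); rewrite lincombE.
    over.
  exact.
have res_lin N : dotE res (lincomb beta N) = 0.
  rewrite dotE_lincomb /zpsum big1// => s _; rewrite big1// => b _.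
  have [[-> ->]|/eqP sb] := eqVneq ((s%:Z - N%:Z)%R, b) (t, a).
    by rewrite beta0 mul0r.
  by rewrite resX ?mulr0.
have res_y : dotE res y = 0.
  have : dotE (lincomb beta N) res @[N --> \oo] --> dotE y res.
    exact: (ip_cvgl C Dl Zl (@dotE_ge0 R d T P)).
  under eq_fun do rewrite C res_lin.
  by move=> /cvg_lim yE; rewrite C -yE// lim_cst.
have resresX : dotE res res = dotE res (vX t a).
  by rewrite {2}/res (ipBr C Dl Zl) res_y subr0.
have resE N : res - (vX t a - lincomb beta N) = (-1) *: (y - lincomb beta N).
  by rewrite scaleN1r /res !opprB addrC addrA subrK.
have cvg_res : dotE (res - (vX t a - lincomb beta N))
    (res - (vX t a - lincomb beta N)) @[N --> \oo] --> 0.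
  under eq_fun do rewrite resE Zl (ipZr C Zl) mulrA mulrNN mulr1 mul1r.
  exact: ycvg.
have lo_le N : (`|t| <= N)%N -> lo <= 2 * dotE res res +
    2 * dotE (y - lincomb beta N) (y - lincomb beta N).
  move=> tN; have := ip_normD_le C Dl Zl (@dotE_ge0 R d T P) res (y - lincomb beta N).
  apply: le_trans.
  have -> : res + (y - lincomb beta N) =
      lincomb (fun s b => 1 * (((s, b) == (t, a))%:R - beta s b)) N.
    by rewrite lincombZB scale1r lincomb_delta// /res addrA subrK.
  have /andP[+ _] := dotE_lincomb_bounds hX hlo hhi
    (fun s b => 1 * (((s, b) == (t, a))%:R - beta s b)) N.
  apply: le_trans; rewrite (ler_peMr (ltW lo_gt0))//.
  rewrite zpsumE (bigD1_seq t) ?mem_zrange ?zrange_uniq//= (bigD1 a)//=.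
  rewrite eqxx beta0 subr0 mulr1 expr1n -addrA lerDl addr_ge0//.
    by rewrite sumr_ge0// => ? _; rewrite sqr_ge0.
  by rewrite sumr_ge0// => ? _; rewrite sumr_ge0// => ? _; rewrite sqr_ge0.
split => //.
- suff : lo <= 2 * dotE res res + 2 * 0 by move: lo_gt0; lra.
  have c : 2 * dotE res res + 2 * dotE (y - lincomb beta N) (y - lincomb beta N)
      @[N --> \oo] --> 2 * dotE res res + 2 * 0.
    by apply: cvgD; [exact: cvg_cst|apply: cvgM => //; exact: cvg_cst].
  apply: cvgr_to_ge c _.
  by exists `|t|%N => // N; exact: lo_le.
- move=> s b; case: eqP => [[-> ->]|sb]; last by rewrite resX.
  by rewrite mulr1n resresX.
Qed.

(** The dual variables are the residuals divided by their variances; by the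
    definition of the inverse covariances, the t-th row of [D] consists of the
    coefficients of their expansions. *)
Lemma inverse_covariance_dual D : is_inverse_covariance X D ->
  exists e : int -> 'I_p -> L2 P,
    (forall t a s b, dotE (e t a) (vX s b) = ((s, b) == (t, a))%:R) /\
    (forall t a, (let f N := e t a - lincomb (fun s b => D t s a b) N in
      dotE (f N) (f N)) @[N --> \oo] --> 0).
Proof.
move=> [Y [beta [hY hbeta hDE]]].
pose res t a := projT1 (cid (best_predictor_residual (hY t a) (hbeta t a))).
pose s2 t a := dotE (res t a) (res t a).
exists (fun t a => (s2 t a)^-1 *: res t a); split=> [t a s b|t a].
  rewrite Zl /s2 /res; case: cid => r /= [_ r0 -> _].
  by rewrite mulrnAr mulVf// gt_eqF.
rewrite /s2 /res; case: cid => r /= [rE r0 rX rcvg].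
have DE N : (`|t| <= N)%N -> (dotE r r)^-1 *: r - lincomb (fun s b => D t s a b) N =
   (dotE r r)^-1 *: (r - (vX t a - lincomb (beta t a) N)).
  move=> tN; rewrite [in RHS]scalerBr; congr (_ - _).
  rewrite -(lincomb_delta a tN) -lincombZB; congr lincomb.
  apply/funext => s; apply/funext => b; rewrite hDE mxE/= -rE.
  have -> : ((a, t) == (b, s)) = ((s, b) == (t, a)).
    by rewrite !xpair_eqE andbC (eq_sym t) (eq_sym a).
  case: eqP => [[-> ->]|_]; first by rewrite (hbeta _ _).1 subr0 mulr1.
  by rewrite sub0r mulrC.
have : (dotE r r)^-1 * ((dotE r r)^-1 * (let f N := r - (vX t a - lincomb (beta t a) N) in
   dotE (f N) (f N))) @[N --> \oo] --> 0.
  rewrite -(mulr0 (dotE r r)^-1) -[X in _ * X](mulr0 (dotE r r)^-1).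
  by apply: cvgM; [exact: cvg_cst|apply: cvgM => //; exact: cvg_cst].
apply: cvg_trans; apply: near_eq_cvg; exists `|t|%N => // N /= tN.
by rewrite DE// Zl (ipZr C Zl).
Qed.

(** Pair the expansion of the first dual variable with the second one: by duality
    a single term survives. *)
Lemma dual_dotE D (e : int -> 'I_p -> L2 P) :
    (forall t a s b, dotE (e t a) (vX s b) = ((s, b) == (t, a))%:R) ->
    (forall t a, (let f N := e t a - lincomb (fun s b => D t s a b) N in
      dotE (f N) (f N)) @[N --> \oo] --> 0) ->
  forall t a s b, dotE (e t a) (e s b) = D t s a b.
Proof.
move=> eX ecvg t a s b.
have : dotE (lincomb (fun s b => D t s a b) N) (e s b) @[N --> \oo] -->
    dotE (e t a) (e s b).
  by apply: (ip_cvgl C Dl Zl (@dotE_ge0 R d T P)); exact: ecvg.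
move=> /cvg_lim <-//.
apply: cvg_lim => //; apply: cvg_near_cst; exists `|s|%N => // N /= sN.
rewrite C dotE_lincomb.
rewrite -(zpsum_delta (fun s b => D t s a b) b sN).
apply: eq_bigr => s' _; apply: eq_bigr => b' _.
by rewrite eX; case: ifP => _; rewrite ?mulr1 ?mulr0.
Qed.
End InverseCovariance.

(** * Inverse of a finite section of the covariance *)

Lemma big_iota (V : nmodType) (F : nat -> V) m :
  \sum_(j <- iota 0 m) F j = \sum_(j < m) F j.
Proof. by rewrite -[in LHS](subn0 m) -/(index_iota 0 m) big_mkord. Qed.

Lemma mx_norm_coord (R : realDomainType) m n (A : 'M[R]_(m, n)) i j :
  `|A i j| <= mx_norm A.
Proof.
by rewrite mx_normrE; exact: (le_bigmax _ (fun ij => `|A ij.1 ij.2|) (i, j)).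
Qed.

Section Windows.

Definition outside n (s : int) := (s <= 0) || (n%:Z < s).
(** Distance of a time outside 1..n to the window. *)
Definition depth n (s : int) : nat := if s <= 0 then absz (1 - s) else absz (s - n%:Z).

(** Telescoping: 1/(m+1)^2 <= 1/m - 1/(m+1). *)
Lemma sum_inv_sqr_le2 (R : realType) m : \sum_(j < m) (j.+1%:R ^+ 2)^-1 <= 2 :> R.
Proof.
case: m => [|m]; first by rewrite big_ord0.
suff : \sum_(j < m.+1) (j.+1%:R ^+ 2)^-1 <= 2 - m.+1%:R^-1 :> R.
  by move=> /le_trans; apply; rewrite lerBlDr lerDl.
elim: m => [|m IH].
  by rewrite big_ord1 expr1n invr1; lra.
rewrite big_ord_recr/=.
suff : (m.+2%:R ^+ 2)^-1 <= m.+1%:R^-1 - m.+2%:R^-1 :> R.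
  by move=> /(lerD IH) /le_trans; apply; rewrite addrA subrK.
have m0 : 0 < m.+1%:R :> R by [].
rewrite -[m.+2]addn1 natrD -subr_ge0.
move: (m.+1%:R : R) m0 => z z0.
have -> : z^-1 - (z + 1%:R)^-1 - ((z + 1%:R) ^+ 2)^-1 = (z * (z + 1) ^+ 2)^-1.
  by field; lra.
by rewrite invr_ge0 mulr_ge0 ?sqr_ge0 ?ltW.
Qed.

Lemma sum_depth_le4 (R : realType) n N :
  \sum_(s <- zrange N | outside n s) ((depth n s)%:R ^+ 2)^-1 <= 4 :> R.
Proof.
pose g1 (s : int) : R := if s <= 0 then ((absz (1 - s))%:R ^+ 2)^-1 else 0.
pose g2 (s : int) : R := if n%:Z < s then ((absz (s - n%:Z))%:R ^+ 2)^-1 else 0.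
rewrite [leLHS](_ : _ = \sum_(s <- zrange N) g1 s + \sum_(s <- zrange N) g2 s).
  rewrite [4](_ : _ = 2 + 2) ?lerD//; last by rewrite -natrD.
    rewrite (@big_uniq_supp _ _ _ [seq - (j%:Z) | j <- iota 0 N.+1]) ?zrange_uniq//.
    - rewrite big_map big_iota.
      apply: le_trans (sum_inv_sqr_le2 R N.+1); rewrite le_eqVlt; apply/orP; left.
      by apply/eqP/eq_bigr => j _; rewrite /g1 ifT; last lia; congr ((_%:R ^+ 2)^-1); lia.
    - by rewrite map_inj_uniq ?iota_uniq// => i j; lia.
    - by move=> _ /mapP[j + ->]; rewrite mem_iota mem_zrange; lia.
    - move=> s; rewrite mem_zrange /g1 => sN /mapP sn; case: ifP => // s0.
      by exfalso; apply: sn; exists (absz s); rewrite ?mem_iota; lia.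
  rewrite (@big_uniq_supp _ _ _ [seq n%:Z + j.+1%:Z | j <- iota 0 (N - n)]) ?zrange_uniq//.
  - rewrite big_map big_iota.
    apply: le_trans (sum_inv_sqr_le2 R (N - n)); rewrite le_eqVlt; apply/orP; left.
    by apply/eqP/eq_bigr => j _; rewrite /g2 ifT; last lia; congr ((_%:R ^+ 2)^-1); lia.
  - by rewrite map_inj_uniq ?iota_uniq// => i j; lia.
  - by move=> _ /mapP[j + ->]; rewrite mem_iota mem_zrange; lia.
  - move=> s; rewrite mem_zrange /g2 => sN /mapP sn; case: ifP => // s0.
    by exfalso; apply: sn; exists (absz (s - n%:Z)).-1; rewrite ?mem_iota; lia.
rewrite -big_split/= big_mkcond/=; apply: eq_bigr => s _.
rewrite /outside /depth /g1 /g2; case: (boolP (s <= 0)) => s0 /=.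
  by rewrite ifF ?addr0//; lia.
by case: ifP; rewrite add0r.
Qed.

Context (p n m : nat) (idx : 'I_m -> 'I_p * 'I_n) (idx_bij : bijective idx).
Let tau k : int := (idx k).2.+1%:Z.
Let al k : 'I_p := (idx k).1.

(** The window is enumerated by an arbitrary bijection, so that the block
    enumeration of the sample can be plugged in at the end. *)
Lemma window_sum (V : nmodType) (F : 'I_p -> int -> V) :
  \sum_k F (al k) (tau k) = \sum_(a < p) \sum_(i < n) F a i.+1%:Z.
Proof.
rewrite pair_big/= (reindex idx)//=.
exact: onW_bij.
Qed.

Lemma window_inj k l : (tau k, al k) = (tau l, al l) -> k = l.
Proof.
move=> [/= kl1 kl2]; apply: (bij_inj idx_bij).
rewrite [LHS]surjective_pairing [RHS]surjective_pairing; congr (_, _) => //.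
by apply: ord_inj; case: kl1 => ->.
Qed.

Lemma window_surj (s : int) b : ~~ outside n s -> exists k, s = tau k /\ b = al k.
Proof.
rewrite /outside negb_or -ltNge -leNgt => /andP[s0 sn].
have sn' : ((absz s).-1 < n)%N by lia.
have [g gK idxK] := idx_bij; exists (g (b, Ordinal sn')).
by rewrite /tau /al idxK/=; split => //; lia.
Qed.

Lemma window_le k : (0 < tau k) && (tau k <= n%:Z).
Proof. by rewrite /tau; have := ltn_ord (idx k).2; lia. Qed.

End Windows.

Section FiniteSection.
Context (R : realType) (p : nat) d (T : measurableType d) (P : probability T R).
Context (X : int -> 'I_p -> {RV P >-> R}) (hX : centred_L2 X).
Context (lo hi : R) (lo_gt0 : 0 < lo).
Context (hlo : (lo%:E <= lambda_inf (covmx X))%E)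
  (hhi : (lambda_sup (covmx X) <= hi%:E)%E).
Local Notation vX := (vX hX).
Local Notation lincomb := (lincomb hX).
Let C := @dotEC R d T P.
Let Dl := @dotEDl R d T P.
Let Zl := @dotEZl R d T P.
Let ge0 := @dotE_ge0 R d T P.

Lemma lincomb_sum (I : finType) (x : I -> R) (c : I -> int -> 'I_p -> R) N :
  lincomb (fun s b => \sum_k x k * c k s b) N = \sum_k x k *: lincomb (c k) N.
Proof.
under [RHS]eq_bigr do rewrite scaler_sumr.
rewrite exchange_big/=; apply: eq_bigr => s _.
under [RHS]eq_bigr do rewrite scaler_sumr.
rewrite exchange_big/=; apply: eq_bigr => b _.
by rewrite scaler_suml; apply: eq_bigr => k _; rewrite scalerA.
Qed.

Lemma dotE_sum_cvg0 (I : finType) (x : I -> R) (F : I -> nat -> L2 P) :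
  (forall k, dotE (F k N) (F k N) @[N --> \oo] --> 0) ->
  (let f N := \sum_k x k *: F k N in dotE (f N) (f N)) @[N --> \oo] --> 0.
Proof.
move=> F0 /=; elim: (index_enum I) => [|k s IH].
  under eq_fun do rewrite big_nil (ip0l Zl); exact: cvg_cst.
under eq_fun do rewrite big_cons.
have c : 2 * (x k * (x k * dotE (F k N) (F k N))) + 2 *
    (let f N := \sum_(j <- s) x j *: F j N in dotE (f N) (f N)) @[N --> \oo] -->
    2 * (x k * (x k * 0)) + 2 * 0.
  apply: cvgD; apply: cvgM => //; try exact: cvg_cst.
  by apply: cvgM; [exact: cvg_cst|apply: cvgM; [exact: cvg_cst|exact: F0]].
rewrite !mulr0 addr0 in c.
apply: squeeze_cvgr (@cvg_cst _ 0 _ _ _) c.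
apply: nearW => N; rewrite ge0/=.
by rewrite (le_trans (ip_normD_le C Dl Zl ge0 _ _))// Zl (ipZr C Zl).
Qed.

Definition gram n m (idx : 'I_m -> 'I_p * 'I_n) : 'M[R]_m :=
  \matrix_(k, l) covmx X (idx k).2.+1%:Z (idx l).2.+1%:Z (idx k).1 (idx l).1.

(** A vector in the kernel of the Gram matrix gives a linear combination of
    variance 0, and the spectral lower bound makes all its coefficients vanish. *)
Lemma gram_unit n m (idx : 'I_m -> 'I_p * 'I_n) :
  bijective idx -> gram idx \in unitmx.
Proof.
move=> idx_bij; rewrite -row_free_unit -kermx_eq0; apply/rowV0P => v /sub_kermxP vG.
pose tau k : int := (idx k).2.+1%:Z; pose al k := (idx k).1.
pose c s b := \sum_k v 0 k * ((s, b) == (tau k, al k))%:R.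
have tN k : (`|tau k| <= n)%N by have := window_le idx k; rewrite /tau; lia.
have cE k : c (tau k) (al k) = v 0 k.
  rewrite /c (bigD1 k)//= eqxx mulr1 big1 ?addr0// => l lk.
  case: eqP => [/(window_inj idx_bij) kl|]; last by rewrite mulr0.
  by rewrite kl eqxx in lk.
have cX : lincomb c n = \sum_k v 0 k *: vX (tau k) (al k).
  rewrite (lincomb_sum (v 0) (fun k s b => ((s, b) == (tau k, al k))%:R)).
  by apply: eq_bigr => k _; rewrite lincomb_delta.
have c0 : dotE (lincomb c n) (lincomb c n) = 0.
  rewrite {2}cX (ip_sumr C Dl Zl) big1// => l _; rewrite (ipZr C Zl) cX (ip_suml Dl Zl).
  have /matrixP /(_ 0 l) := vG; rewrite !mxE.
  under eq_bigr do rewrite mxE covmxE.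
  by under [in X in _ -> X]eq_bigr do rewrite Zl; move=> ->; rewrite mulr0.
have /andP[+ _] := dotE_lincomb_bounds hX hlo hhi c n.
rewrite c0 pmulr_rle0//.
set S := zpsum _ _ => S0.
apply/rowP => k; rewrite mxE -cE; apply/eqP; rewrite -sqrf_eq0.
rewrite eq_le sqr_ge0 andbT; apply: le_trans S0.
rewrite /S zpsumE (bigD1_seq (tau k)) ?zrange_uniq ?mem_zrange//= (bigD1 (al k))//=.
rewrite -addrA lerDl addr_ge0//.
  by rewrite sumr_ge0// => ? _; rewrite sqr_ge0.
by rewrite sumr_ge0// => ? _; rewrite sumr_ge0// => ? _; rewrite sqr_ge0.
Qed.

Context (D : int -> int -> 'M[R]_p) (hD : is_inverse_covariance X D).

(** Both sides are covariances of the same two dual variables.  This turns the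
    decay of the rows of [D] into decay of its columns. *)
Lemma D_sym t s a b : D t s a b = D s t b a.
Proof.
have [e [eX ecvg]] := inverse_covariance_dual hX lo_gt0 hlo hhi hD.
by rewrite -!(dual_dotE eX ecvg) C.
Qed.

Context (M : R) (hM : forall t (r : seq int), uniq r ->
  \sum_(s <- r) `|s - t|%:~R * mx_norm (D t s) <= M).
Context (hi_ge0 : 0 <= hi).

Section Window.
Context (n m : nat) (idx : 'I_m -> 'I_p * 'I_n) (idx_bij : bijective idx).
Let tau k : int := (idx k).2.+1%:Z.
Let al k : 'I_p := (idx k).1.

(** For t in the window, |t - s| is at least the depth of s, so a first moment of
    the row of [D] at s yields a factor 1/depth. *)
Lemma sum_D_row (s : int) : outside n s ->
  \sum_(i < n) mx_norm (D s i.+1%:Z) <= M / (depth n s)%:R.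
Proof.
move=> so; have d0 : (0 < depth n s)%N.
  by move: so; rewrite /outside /depth; case: ifP => //=; lia.
rewrite ler_pdivlMr ?ltr0n// mulr_suml.
have -> : \sum_(i < n) mx_norm (D s i.+1%:Z) * (depth n s)%:R =
    \sum_(j <- [seq i.+1%:Z | i <- iota 0 n]) mx_norm (D s j) * (depth n s)%:R.
  by rewrite big_map big_iota.
have uq : uniq [seq i.+1%:Z | i <- iota 0 n].
  by rewrite map_inj_uniq ?iota_uniq// => i j; lia.
apply: le_trans (hM s uq); rewrite big_seq [leRHS]big_seq.
apply: ler_sum => _ /mapP[i + ->]; rewrite mem_iota => i_n.
rewrite mulrC ler_wpM2r//; first exact: (@normr_ge0 _ _ (D s i.+1%:Z)).
rewrite pmulrn ler_int; move: so; rewrite /outside /depth; case: ifP => /=; lia.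
Qed.

Context (x : 'I_m -> R) (x1 : forall k, `|x k| <= 1).
Let c s b := \sum_k x k * D (tau k) s (al k) b.

Lemma dual_row_outside s b : outside n s ->
  c s b ^+ 2 <= (p%:R * M) ^+ 2 / (depth n s)%:R ^+ 2.
Proof.
move=> so.
suff H : `|c s b| <= p%:R * (M / (depth n s)%:R).
  rewrite -real_normK ?num_real// -expr_div_n ler_sqr ?nnegrE//; first by rewrite -mulrA.
  by rewrite -mulrA (le_trans _ H).
apply: (le_trans (ler_norm_sum _ _ _)).
apply: (@le_trans _ _ (\sum_k mx_norm (D s (tau k)))).
  apply: ler_sum => k _; rewrite normrM -[leRHS]mul1r ler_pM//.
  rewrite D_sym; exact: (mx_norm_coord (D s (tau k)) b (al k)).
rewrite (window_sum idx_bij (fun a t => mx_norm (D s t))) sumr_const card_ord -[leLHS]mulr_natl.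
by rewrite ler_wpM2l// sum_D_row.
Qed.

Lemma sum_outside N :
  \sum_(s <- zrange N | outside n s) \sum_b c s b ^+ 2 <= 4 * p%:R * (p%:R * M) ^+ 2.
Proof.
apply: (@le_trans _ _ (\sum_(s <- zrange N | outside n s)
   p%:R * (p%:R * M) ^+ 2 * ((depth n s)%:R ^+ 2)^-1)).
  apply: ler_sum => s so; rewrite -mulrA mulr_natl.
  rewrite -[X in _ *+ X]card_ord -sumr_const; apply: ler_sum => b _.
  exact: dual_row_outside.
rewrite -mulr_sumr -(mulrA 4) [leRHS]mulrC ler_wpM2l ?sum_depth_le4//.
by rewrite mulr_ge0// sqr_ge0.
Qed.

(** Truncating the expansion of sum_k x_k e_k to the window leaves the terms
    outside, of bounded variance, and a tail that tends to 0 and is made smaller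
    than 1. *)
Lemma window_approx (e : int -> 'I_p -> L2 P) :
    (forall t a, (let f N := e t a - lincomb (fun s b => D t s a b) N in
      dotE (f N) (f N)) @[N --> \oo] --> 0) ->
  exists u : 'I_m -> R,
    let f := \sum_k x k *: e (tau k) (al k) - \sum_k u k *: vX (tau k) (al k) in
    dotE f f <= 2 * 1 + 2 * (hi * (4 * p%:R * (p%:R * M) ^+ 2)).
Proof.
move=> ecvg; exists (fun k => c (tau k) (al k)) => /=.
have /= := dotE_sum_cvg0 x (fun k => ecvg (tau k) (al k)).
move=> /cvgr_lt /(_ 1 ltr01) [N0 _ HN].
pose N := (N0 + n)%N.
have {HN} := HN N (leq_addr _ _) => /=.
under eq_bigr do rewrite scalerBr.
rewrite sumrB -(lincomb_sum x (fun k s b => D (tau k) s (al k) b)) -/c => HN.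
(* the part of the expansion outside the window *)
pose co s b := if outside n s then c s b else 0.
have <- : lincomb c N - lincomb co N = \sum_k c (tau k) (al k) *: vX (tau k) (al k).
  rewrite -[LHS]scale1r -lincombZB.
  have tN k : (`|tau k| <= N)%N by have := window_le idx k; rewrite /N /tau; lia.
  under [RHS]eq_bigr do rewrite -(lincomb_delta hX (al _) (tN _)).
  rewrite -(lincomb_sum (fun k => c (tau k) (al k))); congr lincomb.
  apply/funext => s; apply/funext => b; rewrite mul1r /co.
  case: ifPn => so.
    rewrite subrr big1// => k _; case: eqP => [[sE _]|]; last by rewrite mulr0.
    by move: so (window_le idx k); rewrite sE /tau /outside; lia.
  have [k [-> ->]] := window_surj idx_bij b so.
  rewrite subr0 (bigD1 k)//= eqxx mulr1 big1 ?addr0// => l lk.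
  case: eqP => [/(window_inj idx_bij) kl|]; last by rewrite mulr0.
  by rewrite kl eqxx in lk.
rewrite opprB addrCA addrC.
rewrite (le_trans (ip_normD_le C Dl Zl ge0 _ _))// lerD// ler_wpM2l//; first exact: ltW.
have /andP[_] := dotE_lincomb_bounds hX hlo hhi co N.
move=> /le_trans; apply; rewrite ler_wpM2l//.
apply: le_trans (sum_outside N); rewrite zpsumE big_mkcond/= le_eqVlt.
apply/orP; left; apply/eqP; rewrite [RHS]big_mkcond; apply: eq_bigr => s _.
rewrite /co; case: ifP => // _; rewrite big1// => b _; exact: expr0n.
Qed.

End Window.

(** The finite section of the inverse and the inverse of the finite section
    differ by a form that is bounded on the unit cube, independently of the
    length of the window. *)
Lemma finite_section_inverse n m (idx : 'I_m -> 'I_p * 'I_n) (x y : 'I_m -> R) :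
  bijective idx -> (forall k, `|x k| <= 1) -> (forall k, `|y k| <= 1) ->
  `|\sum_k \sum_l x k * (D (idx k).2.+1%:Z (idx l).2.+1%:Z (idx k).1 (idx l).1
       - invmx (gram idx) k l) * y l|
    <= 2 * 1 + 2 * (hi * (4 * p%:R * (p%:R * M) ^+ 2)).
Proof.
move=> idx_bij x1 y1.
have [e [eX ecvg]] := inverse_covariance_dual hX lo_gt0 hlo hhi hD.
have [u ux] := window_approx idx_bij x1 ecvg.
have [v vy] := window_approx idx_bij y1 ecvg.
have := gram_inverse_residual C Dl Zl ge0 _ (gram_unit idx_bij) _ ux vy.
under eq_bigr do under eq_bigr do rewrite (dual_dotE eX ecvg).
apply.
  by move=> k l; rewrite mxE covmxE.
move=> k l; rewrite eX; congr (_%:R); congr nat_of_bool.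
by apply/eqP/eqP => [/(window_inj idx_bij)|->].
Qed.

End FiniteSection.

(** * Riemann sums of oscillating functions *)

Section OscillatoryRiemannSums.
Context (R : realType).
Local Notation mu := (@lebesgue_measure R).

Lemma lipschitz_continuous (f : R -> R) (L : R) :
  (forall u v, `|f u - f v| <= L * `|u - v|) -> continuous f.
Proof.
move=> fL x; apply/cvgrPdist_le => e e0.
have L1 : 0 < `|L| + 1 by rewrite ltr_pwDr.
have /cvgrPdist_le /(_ _ (divr_gt0 e0 L1)) : id @ nbhs x --> x by exact: cvg_id.
apply: filterS => y /= xy; rewrite (le_trans (fL _ _))//.
apply: (@le_trans _ _ ((`|L| + 1) * (e / (`|L| + 1)))).
  by rewrite (le_trans (ler_norm _))// normrM normr_id ler_pM// lerDl.
by rewrite mulrC divfK ?gt_eqF.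
Qed.

Lemma integrable_itv (f : R -> R) (a b : R) : continuous f ->
  mu.-integrable `[a, b] (EFin \o f).
Proof.
move=> cf; apply: continuous_compact_integrable; first exact: segment_compact.
exact: continuous_subspaceT.
Qed.

(** On a cell the slow factor [f] is frozen at the right end point, while the
    oscillating factor [g] is integrated exactly. *)
Lemma cell_bound (f g G : R -> R) (L a b : R) : a < b ->
  (forall u v, `|f u - f v| <= L * `|u - v|) ->
  continuous g -> (forall u, `|g u| <= 1) -> (forall u : R, is_derive u 1 G (g u)) ->
  `|(\int[mu]_(u in `[a, b]) (f u * g u))%R - f b * (G b - G a)| <= L * (b - a) ^+ 2.
Proof.
move=> ab fL cg g1 GD.
have L0 : 0 <= L.
  by have := le_trans (normr_ge0 _) (fL b a); rewrite pmulr_lge0// gtr0_norm ?subr_gt0.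
have cf := lipschitz_continuous fL.
have cG : continuous G.
  move=> x; apply: differentiable_continuous; apply/derivable1_diffP.
  by have [] := GD x.
have Gint : (\int[mu]_(u in `[a, b]) g u)%R = G b - G a.
  rewrite /Rintegral (@continuous_FTC2 _ g G)//.
  - exact: continuous_subspaceT.
  - split => //.
    + exact: cvg_at_right_filter (cG a).
    + exact: cvg_at_left_filter (cG b).
  - by move=> x _; rewrite derive1E; apply: derive_val.
have cfg : continuous (fun u => f u * g u).
  by move=> x; apply: cvgM; [exact: cf|exact: cg].
have cfbg : continuous (fun u => f b * g u).
  by move=> x; apply: cvgM; [exact: cvg_cst|exact: cg].
rewrite -Gint -RintegralZl//; last exact: integrable_itv.
rewrite -RintegralB//; [|exact: integrable_itv|exact: integrable_itv].
have cd : continuous (fun u => f u * g u - f b * g u).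
  by move=> x; apply: cvgB; [exact: cfg|exact: cfbg].
rewrite (le_trans (le_normr_Rintegral _ _))//; first exact: integrable_itv.
have cn : continuous (fun u => `|f u * g u - f b * g u|).
  by move=> x; apply: cvg_norm; exact: cd.
have -> : L * (b - a) ^+ 2 = (\int[mu]_(u in `[a, b]) (L * (b - a)))%R.
  have E : mu `[a, b] = (b - a)%:E by rewrite lebesgue_measure_itv/= lte_fin ab -EFinB.
  rewrite Rintegral_cst// expr2 mulrA; congr (_ * _).
  exact: esym (congr1 fine E).
apply: le_Rintegral => //; [exact: integrable_itv| |].
  by apply: integrable_itv => x; exact: cvg_cst.
move=> u /=; rewrite in_itv/= => /andP[au ub].
rewrite -mulrBl normrM -[leRHS]mulr1 ler_pM//.
by rewrite (le_trans (fL _ _))// ler_wpM2l// distrC ger0_norm ?subr_ge0// lerD2l lerN2.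
Qed.

Lemma cells_bound (f g G : R -> R) (L : R) n m : (0 < n)%N -> (m <= n)%N ->
  (forall u v, `|f u - f v| <= L * `|u - v|) ->
  continuous g -> (forall u, `|g u| <= 1) -> (forall u : R, is_derive u 1 G (g u)) ->
  `|(\int[mu]_(u in `[0, (m%:R / n%:R)%R]) (f u * g u))%R -
    \sum_(t < m) f (t.+1%:R / n%:R) * (G (t.+1%:R / n%:R) - G (t%:R / n%:R))|
  <= m%:R * (L / n%:R ^+ 2).
Proof.
move=> n0 mn fL cg g1 GD.
have n0' : 0 < n%:R :> R by rewrite ltr0n.
have cfg : continuous (fun u => f u * g u).
  by move=> x; apply: cvgM; [exact: lipschitz_continuous fL x|exact: cg].
elim: m mn => [|m IH] mn.
  by rewrite mul0r set_itv1 Rintegral_set1 big_ord0 subr0 normr0 mul0r.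
have mm1 : m%:R / n%:R < m.+1%:R / n%:R :> R.
  by rewrite ltr_pM2r ?invr_gt0// ltr_nat.
have split_int : (\int[mu]_(u in `[0, (m.+1%:R / n%:R)%R]) (f u * g u))%R =
   (\int[mu]_(u in `[0, (m%:R / n%:R)%R]) (f u * g u))%R +
   (\int[mu]_(u in `[(m%:R / n%:R)%R, (m.+1%:R / n%:R)%R]) (f u * g u))%R.
  rewrite -[X in _ = _ + X]Rintegral_itv_obnd_cbnd; last first.
    apply: integrableS (integrable_itv (m%:R / n%:R) (m.+1%:R / n%:R) cfg) => //.
    exact: subset_itv_oc_cc.
  rewrite -(@Rintegral_itvB _ _ (BLeft 0) (BRight (m.+1%:R / n%:R)) (m%:R / n%:R)).
  - by rewrite addrC subrK.
  - exact: integrable_itv.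
  - by rewrite bnd_simp divr_ge0.
  - by rewrite bnd_simp ltW.
have -> : m.+1%:R * (L / n%:R ^+ 2) = m%:R * (L / n%:R ^+ 2) + L / n%:R ^+ 2.
  by rewrite -natr1 mulrDl mul1r.
rewrite split_int big_ord_recr/= opprD addrACA.
rewrite (le_trans (ler_normD _ _))// lerD ?IH//; first exact: ltnW.
have := cell_bound mm1 fL cg g1 GD.
by rewrite -mulrBl -natrB// subSnn expr_div_n expr1n mul1r.
Qed.

(** Summation by parts: up to the error of freezing [f] on the cells, the total
    error is the variation of [f] times the largest discrepancy [B] between the
    partial Riemann sums of [g] and its integral. *)
Lemma riemann_abel (f g G : R -> R) (F L B : R) n : (0 < n)%N ->
  `|f 1| <= F ->
  (forall u v, `|f u - f v| <= L * `|u - v|) ->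
  continuous g -> (forall u, `|g u| <= 1) -> (forall u : R, is_derive u 1 G (g u)) ->
  (forall m, (m <= n)%N ->
    `|n%:R^-1 * \sum_(t < m) g (t.+1%:R / n%:R) - (G (m%:R / n%:R) - G 0)| <= B) ->
  `|n%:R^-1 * \sum_(t < n) f (t.+1%:R / n%:R) * g (t.+1%:R / n%:R)
    - (\int[mu]_(u in `[0, 1]) (f u * g u))%R| <= (F + L) * B + L / n%:R.
Proof.
move=> n0 fF fL cg g1 GD AB.
have n0' : 0 < n%:R :> R by rewrite ltr0n.
have L0 : 0 <= L by have := le_trans (normr_ge0 _) (fL 1 0); rewrite subr0 normr1 mulr1.
pose A m := n%:R^-1 * \sum_(t < m) g (t.+1%:R / n%:R) - (G (m%:R / n%:R) - G 0).
have A0 : A 0%N = 0 by rewrite /A big_ord0 mulr0 mul0r !subrr.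
have B0 : 0 <= B by have := AB 0%N (leq0n _); apply: le_trans.
pose phi t := f (t%:R / n%:R).
have abel m : (m <= n)%N ->
    `|\sum_(t < m) phi t.+1 * (A t.+1 - A t) - phi m * A m| <= m%:R * (L / n%:R * B).
  elim: m => [|m IH] mn; first by rewrite big_ord0 A0 mulr0 subrr normr0 mul0r.
  rewrite big_ord_recr/=.
  have -> : \sum_(t < m) phi t.+1 * (A t.+1 - A t) + phi m.+1 * (A m.+1 - A m) -
      phi m.+1 * A m.+1 = (\sum_(t < m) phi t.+1 * (A t.+1 - A t) - phi m * A m) +
      (phi m - phi m.+1) * A m by ring.
  have -> : m.+1%:R * (L / n%:R * B) = m%:R * (L / n%:R * B) + L / n%:R * B.
    by rewrite -natr1 mulrDl mul1r.
  rewrite (le_trans (ler_normD _ _))// lerD ?IH//; first exact: ltnW.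
  rewrite normrM ler_pM//; last by apply: AB; exact: ltnW.
  rewrite (le_trans (fL _ _))// -mulrBl normrM normfV (gtr0_norm n0').
  by rewrite distrC -natrB// subSnn normr1 mul1r.
have cells := cells_bound n0 (leqnn n) fL cg g1 GD.
move: (abel n (leqnn n)) cells.
have -> : n%:R / n%:R = 1 :> R by rewrite divff ?gt_eqF.
have -> : n%:R * (L / n%:R * B) = L * B by field; rewrite gt_eqF.
have -> : n%:R * (L / n%:R ^+ 2) = L / n%:R by field; rewrite gt_eqF.
set I := Rintegral _ _ _.
have -> : \sum_(t < n) phi t.+1 * (A t.+1 - A t) =
   n%:R^-1 * (\sum_(t < n) f (t.+1%:R / n%:R) * g (t.+1%:R / n%:R)) -
   \sum_(t < n) f (t.+1%:R / n%:R) * (G (t.+1%:R / n%:R) - G (t%:R / n%:R)).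
  rewrite mulr_sumr -sumrB; apply: eq_bigr => t _.
  by rewrite /A big_ord_recr/= /phi; ring.
set S1 := n%:R^-1 * _; set S2 := \sum_(t < n) _ => H1 H2.
have H3 : `|phi n * A n| <= F * B.
  rewrite normrM ler_pM//; last exact: AB.
  by rewrite /phi divff ?gt_eqF.
have -> : S1 - I = (S1 - S2 - phi n * A n) + phi n * A n - (I - S2) by ring.
rewrite (le_trans (ler_normB _ _))// lerD// (le_trans (ler_normD _ _))//.
by rewrite mulrDl addrC lerD.
Qed.

Lemma sin_le_id (x : R) : 0 <= x -> sin x <= x.
Proof.
rewrite le_eqVlt => /predU1P[<-|x0]; first by rewrite sin0.
have D (y : R) : is_derive y 1 (fun x : R => x - sin x) (1 - cos y) by apply: is_deriveB.
have [|c _] := @MVT_segment R (fun x => x - sin x) (fun y => 1 - cos y) 0 x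
    (ltW x0) (fun y _ => D y).
  apply: continuous_subspaceT => y; apply: cvgB; [exact: cvg_id|exact: continuous_sin].
by rewrite sin0 !subr0 => E; rewrite -subr_ge0 E mulr_ge0 ?(ltW x0)// subr_ge0 cos_le1.
Qed.

Lemma cos_le_sinc (x : R) : 0 <= x <= pi -> x * cos x <= sin x.
Proof.
move=> /andP[x0 xpi].
have D (y : R) : is_derive y 1 (fun x : R => sin x - x * cos x) (y * sin y).
  by apply: is_derive_eq; rewrite /GRing.scale/=; ring.
have [|c cx] := @MVT_segment R (fun x => sin x - x * cos x) (fun y => y * sin y) 0 x
    x0 (fun y _ => D y).
  apply: continuous_subspaceT => y; apply: cvgB; first exact: continuous_sin.
  by apply: cvgM; [exact: cvg_id|exact: continuous_cos].
rewrite sin0 mul0r !subr0 => E; rewrite -subr_ge0 E mulr_ge0// mulr_ge0//.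
  by move: cx; rewrite in_itv/= => /andP[].
by apply: sin_ge0_pi; move: cx; rewrite in_itv/= => /andP[-> /le_trans]; apply.
Qed.

(** For x > 0 this says that |x cos x - sin x| <= x sin x, which follows from
    x cos x <= sin x <= x and from 1 = cos^2 + sin^2 <= cos + sin. *)
Lemma cot_sub_inv_bound (x : R) : 0 < `|x| <= pi / 2 ->
  `|cos x / sin x - x^-1| <= 1.
Proof.
wlog x0 : x / 0 < x.
  move=> H xb; have [/H|] := ltP 0 x; first exact.
  rewrite le_eqVlt => /predU1P[x0|x0]; first by rewrite x0 normr0 ltxx in xb.
  have -> : cos x / sin x - x^-1 = - (cos (- x) / sin (- x) - (- x)^-1).
    by rewrite cosN sinN !invrN mulrN; ring.
  by rewrite normrN; apply: H; rewrite ?oppr_gt0 ?normrN.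
rewrite gtr0_norm// => /andP[_ xpi].
have pi0 := pi_gt0 R.
have sx : 0 < sin x by apply: sin_gt0_pi; rewrite x0/=; lra.
have -> : cos x / sin x - x^-1 = (x * cos x - sin x) / (x * sin x).
  by field; rewrite !gt_eqF.
rewrite normrM normfV [X in _ / X]gtr0_norm ?mulr_gt0// ler_pdivrMr ?mulr_gt0// mul1r.
rewrite ler0_norm ?subr_le0; last by apply: cos_le_sinc; apply/andP; split; lra.
rewrite opprB lerBlDr -mulrDr (le_trans (sin_le_id (ltW x0)))// (ler_peMr (ltW x0))//.
rewrite -(cos2Dsin2 x) addrC lerD//.
  by rewrite expr2 (ler_piMr (ltW sx))// sin_le1.
rewrite expr2 ler_piMr ?cos_le1// cos_ge0_pihalf//; apply/andP; split; lra.
Qed.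

Lemma sum_cos (x phi : R) m :
  2 * sin x * \sum_(t < m) cos (2 * x * t.+1%:R + phi) =
  sin (2 * x * m%:R + x + phi) - sin (x + phi).
Proof.
elim: m => [|m IH]; first by rewrite big_ord0 !mulr0 add0r subrr.
rewrite big_ord_recr/= mulrDr IH -[m.+1%:R]natr1.
have -> : 2 * x * (m%:R + 1) + x + phi = (2 * x * (m%:R + 1) + phi) + x by ring.
have -> : 2 * x * m%:R + x + phi = (2 * x * (m%:R + 1) + phi) - x by ring.
set A := 2 * x * (m%:R + 1) + phi.
by rewrite sinB (sinD A x); ring.
Qed.

(** Both the partial sum and the integral of the cosine are differences of two
    sines; after expansion of the sines the discrepancy involves the angle
    x = pi r / n only through cot x - 1/x. *)
Lemma cos_riemann_error (r : int) (phi : R) n m : (0 < n)%N ->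
  `|r|%:~R <= n%:R / 2 :> R -> r != 0 ->
  `|n%:R^-1 * \sum_(t < m) cos (2 * pi * r%:~R * (t.+1%:R / n%:R) + phi) -
    ((2 * pi * r%:~R)^-1 * sin (2 * pi * r%:~R * (m%:R / n%:R) + phi) -
     (2 * pi * r%:~R)^-1 * sin (2 * pi * r%:~R * 0 + phi))| <= 2 / n%:R.
Proof.
move=> n0 rn r0.
have n0' : 0 < n%:R :> R by rewrite ltr0n.
have pi0 := pi_gt0 R.
have r0' : r%:~R != 0 :> R by rewrite intr_eq0.
pose x : R := pi * r%:~R / n%:R.
have nn0 := lt0r_neq0 n0'; have pn0 := lt0r_neq0 pi0.
have x0 : x != 0 by rewrite /x !mulf_neq0 ?invr_eq0.
have xb : 0 < `|x| <= pi / 2.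
  rewrite normr_gt0 x0/= /x !normrM normfV (gtr0_norm pi0) (gtr0_norm n0').
  rewrite -mulrA (ler_wpM2l (ltW pi0))// ler_pdivrMr// mulrC -intr_norm.
  exact: rn.
have sx : sin x != 0.
  have /andP[xl xu] := xb.
  have [xp|xn] := ltP 0 x.
    rewrite gt_eqF// sin_gt0_pi// xp/=; rewrite gtr0_norm// in xu; lra.
  have xn' : 0 < - x by rewrite oppr_gt0 lt_def eq_sym x0.
  rewrite -oppr_eq0 -sinN gt_eqF// sin_gt0_pi// xn'/=.
  by rewrite -normrN gtr0_norm// in xu; lra.
have cotb := cot_sub_inv_bound xb.
have argE (k : nat) : 2 * pi * r%:~R * (k%:R / n%:R) + phi = 2 * x * k%:R + phi.
  by rewrite /x; field; rewrite gt_eqF.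
rewrite mulr0 add0r argE; under eq_bigr do rewrite argE.
have -> : \sum_(t < m) cos (2 * x * t.+1%:R + phi) =
    (sin (2 * x * m%:R + x + phi) - sin (x + phi)) / (2 * sin x).
  by rewrite -sum_cos mulrAC divff ?mul1r// mulf_neq0.
have -> : 2 * pi * r%:~R = 2 * x * n%:R by rewrite /x; field; rewrite gt_eqF.
rewrite (addrAC _ x phi) (addrC x phi) !sinD.
set s1 := sin (2 * x * m%:R) * _ + _; set c1 := cos (2 * x * m%:R + phi).
have -> : n%:R^-1 * ((s1 * cos x + c1 * sin x - (sin phi * cos x + cos phi * sin x)) /
    (2 * sin x)) - ((2 * x * n%:R)^-1 * s1 - (2 * x * n%:R)^-1 * sin phi) =
    (2 * n%:R)^-1 * ((s1 - sin phi) * (cos x / sin x - x^-1) + (c1 - cos phi)).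
  by field; rewrite x0 sx gt_eqF.
have s1E : s1 = sin (2 * x * m%:R + phi) by rewrite sinD.
rewrite normrM gtr0_norm ?invr_gt0 ?mulr_gt0// mulrC ler_pdivrMr ?mulr_gt0//.
have -> : 2 / n%:R * (2 * n%:R) = 2 * 1 + 2 :> R by field; rewrite gt_eqF.
rewrite (le_trans (ler_normD _ _))// lerD//.
  rewrite normrM ler_pM// s1E (le_trans (ler_normB _ _))//.
  by have := sin_max (2 * x * m%:R + phi); have := sin_max phi; lra.
rewrite (le_trans (ler_normB _ _))// /c1.
by have := cos_max (2 * x * m%:R + phi); have := cos_max phi; lra.
Qed.

(** The bound does not grow with the frequency r, up to the Nyquist frequency
    n/2.  The phase covers the sine as well. *)
Lemma riemann_sum_cos (f : R -> R) (F L phi : R) (r : int) n : (0 < n)%N ->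
  `|f 1| <= F -> (forall u v, `|f u - f v| <= L * `|u - v|) ->
  `|r|%:~R <= n%:R / 2 :> R ->
  `|n%:R^-1 * \sum_(t < n) f (t.+1%:R / n%:R) *
        cos (2 * pi * r%:~R * (t.+1%:R / n%:R) + phi)
    - (\int[mu]_(u in `[0, 1]) (f u * cos (2 * pi * r%:~R * u + phi)))%R|
  <= (2 * F + 3 * L) / n%:R.
Proof.
move=> n0 fF fL rn.
have n0' : 0 < n%:R :> R by rewrite ltr0n.
have -> : (2 * F + 3 * L) / n%:R = (F + L) * (2 / n%:R) + L / n%:R by ring.
have carg (x : R) : continuous (fun u : R => x * u + phi).
  move=> u; apply: cvgD; last exact: cvg_cst.
  by apply: cvgM; [exact: cvg_cst|exact: cvg_id].
have [->|r0] := eqVneq r 0.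
  have -> : 2 * pi * 0%:~R = 0 :> R by rewrite mulr0z mulr0.
  pose G (u : R) := u * cos phi.
  apply: (riemann_abel (g := fun u => cos (0 * u + phi)) (G := G)) => //.
  - by move=> u; apply: continuous_comp; [exact: carg|exact: continuous_cos].
  - by move=> u; exact: cos_max.
  - move=> u; rewrite mul0r add0r /G.
    by apply: is_derive_eq; rewrite /GRing.scale/=; ring.
  move=> m mn; rewrite /G.
  under eq_bigr do rewrite mul0r add0r.
  rewrite sumr_const card_ord -[cos phi *+ m]mulr_natl.
  have -> : n%:R^-1 * (m%:R * cos phi) - (m%:R / n%:R * cos phi - 0 * cos phi) = 0.
    by ring.
  by rewrite normr0 divr_ge0.
pose w : R := 2 * pi * r%:~R.
have pn0 := lt0r_neq0 (pi_gt0 R).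
have w0 : w != 0 by rewrite /w !mulf_neq0 ?intr_eq0.
pose G (u : R) := w^-1 * sin (w * u + phi).
apply: (riemann_abel (g := fun u => cos (w * u + phi)) (G := G)) => //.
- by move=> u; apply: continuous_comp; [exact: carg|exact: continuous_cos].
- by move=> u; exact: cos_max.
- move=> u; rewrite /G.
  have D : is_derive u 1 (fun u : R => w * u + phi) w.
    by apply: is_derive_eq; rewrite /GRing.scale/=; ring.
  have D2 := @is_derive1_comp R sin (fun u : R => w * u + phi) u _ _
    (is_derive_sin (w * u + phi)) D.
  have D3 : is_derive u 1 (w^-1 *: (sin \o (fun u : R => w * u + phi)))
      (w^-1 *: (cos (w * u + phi) * w)) by exact: is_deriveZ.
  apply: (is_derive_eq D3).
  by rewrite /GRing.scale/= mulrCA mulVf ?mulr1.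
by move=> m mn; rewrite /G /w; exact: cos_riemann_error.
Qed.

End OscillatoryRiemannSums.

(** * Complex sequences and bilateral series *)

Section ComplexTools.
Context (R : realType).

Lemma expiD (x y : R) : expi (x + y) = expi x * expi y.
Proof. by apply/eqP; rewrite eq_complex/= cosD sinD addrC eqxx (addrC (sin x * _)) eqxx. Qed.

Lemma expi0 : expi 0 = 1 :> R[i].
Proof. by rewrite /expi cos0 sin0. Qed.

Lemma Re_expi (x : R) : complex.Re (expi x) = cos x. Proof. by []. Qed.
Lemma Im_expi (x : R) : complex.Im (expi x) = sin x. Proof. by []. Qed.

Lemma norm_expi (x : R) : `|expi x| = 1.
Proof. by rewrite normc_def/= cos2Dsin2 sqrtr1. Qed.

Lemma norm_realc (x : R) : `|x%:C| = `|x|%:C.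
Proof. by rewrite normc_def/= expr0n/= addr0 sqrtr_sqr. Qed.

Lemma expi_periodic (x : R) n : expi (x + 2 * pi * n%:R) = expi x.
Proof.
have -> : 2 * pi * n%:R = pi *+ 2 *+ n :> R by rewrite -(mulr_natr _ n) -(mulr_natr pi 2); ring.
rewrite /expi; congr (_ +i* _).
  exact: (periodicn (@cosD2pi R)).
exact: (periodicn (@sinD2pi R)).
Qed.

Lemma conj_expi (x : R) : (expi x)^*%C = expi (- x).
Proof. by rewrite /expi cosN sinN. Qed.

Lemma ReD (x y : R[i]) : complex.Re (x + y) = complex.Re x + complex.Re y.
Proof. by case: x y => [? ?] [? ?]. Qed.
Lemma ImD (x y : R[i]) : complex.Im (x + y) = complex.Im x + complex.Im y.
Proof. by case: x y => [? ?] [? ?]. Qed.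
Lemma ReM (x y : R[i]) : complex.Re (x * y) =
  complex.Re x * complex.Re y - complex.Im x * complex.Im y.
Proof. by case: x y => [? ?] [? ?]. Qed.
Lemma ImM (x y : R[i]) : complex.Im (x * y) =
  complex.Re x * complex.Im y + complex.Im x * complex.Re y.
Proof. by case: x y => [? ?] [? ?]. Qed.
Lemma Re_sum I (s : seq I) (F : I -> R[i]) :
  complex.Re (\sum_(i <- s) F i) = \sum_(i <- s) complex.Re (F i).
Proof. exact: (big_morph _ ReD (erefl : complex.Re 0 = 0)). Qed.
Lemma Im_sum I (s : seq I) (F : I -> R[i]) :
  complex.Im (\sum_(i <- s) F i) = \sum_(i <- s) complex.Im (F i).
Proof. exact: (big_morph _ ImD (erefl : complex.Im 0 = 0)). Qed.

Lemma normc_ge_Im (z : R[i]) : `|complex.Im z|%:C <= `|z|.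
Proof. by rewrite normc_def lecR -sqrtr_sqr ler_wsqrtr// lerDr sqr_ge0. Qed.

Lemma normc_le_ReIm (z : R[i]) (x y : R) :
  `|complex.Re z| <= x -> `|complex.Im z| <= y -> `|z| <= (x + y)%:C.
Proof.
move=> zx zy; rewrite normc_def lecR.
have x0 := le_trans (normr_ge0 _) zx; have y0 := le_trans (normr_ge0 _) zy.
rewrite -[leRHS]ger0_norm ?addr_ge0// -sqrtr_sqr ler_wsqrtr//.
rewrite -real_normK ?num_real// -[X in _ + X]real_normK ?num_real//.
apply: (@le_trans _ _ (x ^+ 2 + y ^+ 2)).
  by rewrite lerD// ler_sqr// nnegrE.
rewrite -subr_ge0 (_ : _ - _ = 2 * (x * y)) ?mulr_ge0//; ring.
Qed.

(** Convergence of the real and imaginary parts, the form in which bilateral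
    complex series are defined. *)
Definition ccvg (z : nat -> R[i]) (l : R[i]) : Prop :=
  (complex.Re (z N) @[N --> \oo] --> complex.Re l) /\
  (complex.Im (z N) @[N --> \oo] --> complex.Im l).

Lemma ccvg_cst c : ccvg (fun=> c) c.
Proof. by split; exact: cvg_cst. Qed.

Lemma ccvgB z1 z2 l1 l2 : ccvg z1 l1 -> ccvg z2 l2 ->
  ccvg (fun N => z1 N - z2 N) (l1 - l2).
Proof.
have ReN (x : R[i]) : complex.Re (- x) = - complex.Re x by case: x.
have ImN (x : R[i]) : complex.Im (- x) = - complex.Im x by case: x.
move=> [R1 I1] [R2 I2]; split.
  by under eq_fun do rewrite ReD ReN; rewrite ReD ReN; apply: cvgB.
by under eq_fun do rewrite ImD ImN; rewrite ImD ImN; apply: cvgB.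
Qed.

Lemma ccvgMl c z l : ccvg z l -> ccvg (fun N => c * z N) (c * l).
Proof.
move=> [zR zI]; split.
  under eq_fun do rewrite ReM; rewrite ReM.
  by apply: cvgB; apply: cvgM => //; exact: cvg_cst.
under eq_fun do rewrite ImM; rewrite ImM.
by apply: cvgD; apply: cvgM => //; exact: cvg_cst.
Qed.

Lemma ccvg_sum I (s : seq I) (z : I -> nat -> R[i]) (l : I -> R[i]) :
  (forall i, ccvg (z i) (l i)) ->
  ccvg (fun N => \sum_(i <- s) z i N) (\sum_(i <- s) l i).
Proof.
move=> zl; elim: s => [|i s [IR II]].
  by rewrite big_nil; under eq_fun do rewrite big_nil; exact: ccvg_cst.
rewrite big_cons; under eq_fun do rewrite big_cons.
have [zR zI] := zl i; split.
  by under eq_fun do rewrite ReD; rewrite ReD; apply: cvgD.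
by under eq_fun do rewrite ImD; rewrite ImD; apply: cvgD.
Qed.

Lemma ccvg_norm_le z l (B : R) n : ccvg z l ->
  (forall N, (n <= N)%N -> `|z N| <= B%:C) -> `|l| <= (B + B)%:C.
Proof.
move=> [zR zI] zB; apply: normc_le_ReIm.
  apply: (cvgr_to_le (cvg_norm zR)); exists n => // N /= nN.
  by rewrite -lecR (le_trans (normc_ge_Re _))// zB.
apply: (cvgr_to_le (cvg_norm zI)); exists n => // N /= nN.
by rewrite -lecR (le_trans (normc_ge_Im _))// zB.
Qed.

End ComplexTools.

Section BilateralSeries.
Context (R : realType).

Lemma zpsum0 (V : nmodType) (f : int -> V) : zpsum f 0 = f 0.
Proof. by rewrite /zpsum big_ord1. Qed.

Lemma zpsumS (V : nmodType) (f : int -> V) N :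
  zpsum f N.+1 = zpsum f N + (f N.+1%:Z + f (- N.+1%:Z)).
Proof.
have perm_S : perm_eq (zrange N.+1) [:: N.+1%:Z, - N.+1%:Z & zrange N].
  apply: uniq_perm; first exact: zrange_uniq.
    by rewrite 2!cons_uniq zrange_uniq in_cons !mem_zrange; lia.
  by move=> s; rewrite [in RHS]in_cons [in RHS]in_cons !mem_zrange; lia.
by rewrite !zpsumE (perm_big _ perm_S)/= 2!big_cons addrA addrC.
Qed.

(** A symmetric sum is, up to its central term, a one-sided series whose terms
    are the pairs of opposite terms; it converges absolutely. *)
Lemma zsum_cvg (f w : int -> R) (S : R) :
  (forall j, `|f j| <= w j) ->
  (forall r : seq int, uniq r -> \sum_(j <- r) w j <= S) ->
  zpsum f N @[N --> \oo] --> zsum f.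
Proof.
move=> fw wS; suff : cvgn (zpsum f) by [].
pose g (k : nat) := f k.+1%:Z + f (- k.+1%:Z).
have fE : zpsum f = (fun N => f 0 + series g N).
  apply/funext; elim=> [|N IH].
    by rewrite zpsum0 /series/= big_geq// addr0.
  by rewrite zpsumS IH /series/= big_nat_recr//= [RHS]addrA.
rewrite fE; apply: is_cvgD; first exact: is_cvg_cst.
apply: normed_cvg; apply: nondecreasing_is_cvgn.
  by apply/nondecreasing_seqP => N; rewrite /normed_series_of /= seriesSr lerDl normr_ge0.
exists (S - w 0) => _ [N _ <-].
have : zpsum w N <= S by rewrite zpsumE wS ?zrange_uniq.
rewrite lerBrDl; apply: le_trans.
elim: N => [|N IH]; first by rewrite /normed_series_of /= /series/= big_geq// addr0 zpsum0.
rewrite zpsumS /normed_series_of /= seriesSr [leLHS]addrA lerD//.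
by rewrite /g (le_trans (ler_normD _ _))// lerD.
Qed.

Lemma zsum_le (f w : int -> R) (S : R) :
  (forall j, `|f j| <= w j) ->
  (forall r : seq int, uniq r -> \sum_(j <- r) w j <= S) -> `|zsum f| <= S.
Proof.
move=> fw wS; apply: (cvgr_to_le (cvg_norm (zsum_cvg fw wS))).
apply: nearW => N; rewrite zpsumE (le_trans (ler_norm_sum _ _ _))//.
by apply: le_trans (wS _ (zrange_uniq N)); apply: ler_sum.
Qed.

Lemma zsumB (f g w : int -> R) (S : R) :
  (forall j, `|f j| <= w j) -> (forall j, `|g j| <= w j) ->
  (forall r : seq int, uniq r -> \sum_(j <- r) w j <= S) ->
  zsum (fun j => f j - g j) = zsum f - zsum g.
Proof.
move=> fw gw wS; apply: cvg_lim => //.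
have -> : zpsum (fun j => f j - g j) = (fun N => zpsum f N - zpsum g N).
  by apply/funext => N; rewrite /zpsum sumrB.
by apply: cvgB; [exact: zsum_cvg fw wS|exact: zsum_cvg gw wS].
Qed.

Lemma czsum_ccvg (f : int -> R[i]) (w : int -> R) (S : R) :
  (forall j, `|f j| <= (w j)%:C) ->
  (forall r : seq int, uniq r -> \sum_(j <- r) w j <= S) ->
  ccvg (zpsum f) (czsum f).
Proof.
move=> fw wS; split.
  under eq_fun do rewrite Re_sum.
  apply: zsum_cvg wS => j; rewrite -lecR; exact: le_trans (normc_ge_Re _) (fw j).
under eq_fun do rewrite Im_sum.
apply: zsum_cvg wS => j; rewrite -lecR; exact: le_trans (normc_ge_Im _) (fw j).
Qed.

(** From here on, summability is used as a bound on all finite partial sums. *)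
Lemma esum_sum_le (A : set int) (f : int -> R) (B : R) (r : seq int) :
  (\esum_(j in A) (f j)%:E <= B%:E)%E -> uniq r -> [set` r] `<=` A ->
  \sum_(j <- r) f j <= B.
Proof.
move=> fB ur rA; rewrite -lee_fin; apply: le_trans fB.
apply: ereal_sup_ubound; exists [set` r].
  by split => //; exact: finite_seq.
by rewrite -fsbig_seq// sumEFin.
Qed.

End BilateralSeries.

(** * Locally stationary inverse covariances *)

Section LocalApproximation.
Context (R : realType) (p : nat).

(** The form in which local stationarity is used: a single family of weights
    with a first moment controls the size of the limiting functions on [0, 1],
    their variation, and the error of the approximation. *)
Record stationary_weights (D : nat -> int -> int -> 'M[R]_p) (Dlim : int -> R -> 'M[R]_p)
    (w : int -> R) (S M : R) : Prop := StationaryWeights {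
  weight_ge0 : forall j, 0 <= w j;
  weight_sum : forall r : seq int, uniq r -> \sum_(j <- r) (1 + `|j|%:~R) * w j <= S;
  weight_lipschitz : forall j u v a b,
    `|Dlim j u a b - Dlim j v a b| <= `|u - v| * w j;
  weight_bound : forall j u a b, 0 <= u <= 1 -> `|Dlim j u a b| <= w j;
  weight_approx_ge0 : 0 <= M;
  weight_approx : forall n t tau a b, (0 < n)%N ->
    `|D n t tau a b - Dlim (t - tau) ((t + tau)%:~R / (2 * n%:R)) a b|
      <= M / n%:R * w (t - tau)
}.

Lemma mxnorm1_coord (A : 'M[R]_p) a b : `|A a b| <= mxnorm1 A.
Proof.
rewrite /mxnorm1 (bigD1 a)//= (bigD1 b)//= -addrA lerDl addr_ge0//.
  by rewrite sumr_ge0.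
by rewrite sumr_ge0// => *; rewrite sumr_ge0.
Qed.

(** Take w(j) = |D_j(0)| + 1/ell(j): for u in [0, 1] the Lipschitz condition
    bounds |D_j(u)| by w(j), so that the moment condition at u = 0 controls the
    whole interval. *)
Lemma locally_stationary_weights D Dlim : locally_stationary D Dlim ->
  exists w S M, stationary_weights D Dlim w S M.
Proof.
move=> [ell [[ell0 hell [M hM]] [hsup _ hlip]]].
pose w j := mxnorm1 (Dlim j 0) + (ell j)^-1.
have mx0 (A : 'M[R]_p) : 0 <= mxnorm1 A by move=> *; rewrite sumr_ge0// => *; rewrite sumr_ge0.
have w0 j : 0 <= w j by rewrite /w addr_ge0// invr_ge0 ltW.
set E1 := esum _ _ in hell; set E2 := ereal_sup _ in hsup.
have E1f : E1 = (fine E1)%:E.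
  by rewrite fineK// ge0_fin_numE//; apply: esum_ge0 => j _; rewrite lee_fin divr_ge0// ltW.
have E2ge : (\esum_(j in [set: int]) (mxnorm1 (j%:~R *: Dlim j 0))%:E <= E2)%E.
  by apply: ereal_sup_ubound; exists 0.
have E2f : E2 = (fine E2)%:E.
  rewrite fineK// ge0_fin_numE//; apply: le_trans E2ge.
  by apply: esum_ge0 => j _; rewrite lee_fin.
have ellb r : uniq r -> \sum_(j <- r) `|j|%:~R / ell j <= fine E1.
  by move=> ur; apply: (@esum_sum_le _ setT) => //; rewrite -E1f.
have mxb r : uniq r -> \sum_(j <- r) `|j|%:~R * mxnorm1 (Dlim j 0) <= fine E2.
  move=> ur; rewrite (eq_bigr (fun j => mxnorm1 (j%:~R *: Dlim j 0))); last first.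
    move=> j _; rewrite /mxnorm1 mulr_sumr; apply: eq_bigr => a _.
    by rewrite mulr_sumr; apply: eq_bigr => b _; rewrite !mxE normrM intr_norm.
  by apply: (@esum_sum_le _ setT) => //; rewrite -E2f.
exists w, (w 0 + 2 * (fine E1 + fine E2)), `|M|; split=> //.
- move=> r ur.
  have wb : \sum_(j <- r) `|j|%:~R * w j <= fine E1 + fine E2.
    rewrite addrC; under eq_bigr do rewrite mulrDr.
    by rewrite big_split lerD ?mxb ?ellb.
  apply: (@le_trans _ _ (\sum_(j <- r) ((if j == 0 then w 0 else 0) + 2 * (`|j|%:~R * w j)))).
    apply: ler_sum => j _; case: eqVneq => [->|j0].
      by rewrite normr0 mulr0z mul0r mulr0 !addr0 mul1r.
    rewrite add0r mulrA ler_wpM2r// mulr_natl mulr2n lerD2r ler1z.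
    by rewrite -gtz0_ge1 normr_gt0.
  rewrite big_split/= -mulr_sumr lerD// ?ler_wpM2l//.
  have [r0|r0] := boolP (0 \in r).
    by rewrite (bigD1_seq 0)//= big1 ?addr0// => j /negPf ->.
  rewrite big_seq big1// => j jr; case: eqVneq => // j0.
  by rewrite -j0 jr in r0.
- move=> j u v a b; have := mxnorm1_coord (Dlim j u - Dlim j v) a b; rewrite !mxE.
  move=> /le_trans; apply; rewrite (le_trans (hlip j u v))// ler_wpM2l// lerDr.
  exact: mx0.
- move=> j u a b /andP[u0 u1].
  rewrite -(subrK (Dlim j 0 a b) (Dlim j u a b)) (le_trans (ler_normD _ _))// addrC.
  rewrite lerD ?mxnorm1_coord//.
  have := mxnorm1_coord (Dlim j u - Dlim j 0) a b; rewrite !mxE => /le_trans; apply.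
  rewrite (le_trans (hlip j u 0))// subr0 ger0_norm//.
  by rewrite ler_piMl// invr_ge0 ltW.
move=> n t tau a b n0.
have := mx_norm_coord (D n t tau - Dlim (t - tau) ((t + tau)%:~R / (2 * n%:R))) a b.
rewrite !mxE => /le_trans; apply; rewrite (le_trans (hM n n0 t tau))//.
apply: (@le_trans _ _ (`|M| / n%:R * (ell (t - tau))^-1)).
  rewrite -mulrA -invfM; apply: ler_wpM2r; last exact: ler_norm.
  by rewrite invr_ge0 mulr_ge0// ltW.
by rewrite ler_wpM2l ?divr_ge0// /w lerDr; exact: mx0.
Qed.

Context (D : nat -> int -> int -> 'M[R]_p) (Dlim : int -> R -> 'M[R]_p)
  (w : int -> R) (S M : R) (W : stationary_weights D Dlim w S M).

Lemma weight_sum1 (r : seq int) : uniq r -> \sum_(j <- r) w j <= S.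
Proof.
move=> ur; apply: le_trans (weight_sum W ur); apply: ler_sum => j _.
by rewrite ler_peMl ?(weight_ge0 W)// lerDl ler0z.
Qed.

Lemma Gamma_ccvg a b u om : 0 <= u <= 1 ->
  ccvg (zpsum (fun j => (Dlim j u a b)%:C * expi (- (j%:~R * om))))
    (Gamma Dlim a b u om).
Proof.
move=> u01; apply: czsum_ccvg weight_sum1 => j.
by rewrite normrM norm_expi mulr1 norm_realc lecR (weight_bound W).
Qed.

Lemma count_lt (j n : nat) : (\sum_(t < n) (t < j)%N <= j)%N.
Proof.
suff -> : (\sum_(t < n) (t < j)%N = minn n j)%N by exact: geq_minr.
by elim: n => [|n IH]; rewrite ?big_ord0 ?min0n// big_ord_recr/= IH; case: ltnP; lia.
Qed.

Lemma count_ge (j n : nat) : (\sum_(t < n) (n <= t + j)%N <= j)%N.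
Proof.
suff -> (c : nat) : (\sum_(t < n) (c <= t + j)%N = n - (c - j))%N by lia.
by elim: n => [|n IH]; rewrite ?big_ord0// big_ord_recr/= IH; case: leqP; lia.
Qed.

(** Times are counted from 0 here, as ordinals are: the lag [j] leads from the
    time [t] to a time outside 0..n-1. *)
Definition leaves n (t : nat) (j : int) := (t%:Z - j < 0) || (n%:Z <= t%:Z - j).

(** A lag j > 0 leaves the window only from its first j times, and a lag j < 0
    only from its last |j| times. *)
Lemma count_leaves n j : (\sum_(t < n) leaves n t j <= `|j|)%N.
Proof.
have [j0|j0] := leP 0 j.
  apply: leq_trans (count_lt `|j|%N n); apply: leq_sum => t _.
  by rewrite /leaves; have := ltn_ord t; lia.
apply: leq_trans (count_ge `|j|%N n); apply: leq_sum => t _.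
by rewrite /leaves; have := ltn_ord t; lia.
Qed.

Lemma zpsum_window (V : zmodType) (h : int -> V) n N (t : 'I_n) : (n <= N)%N ->
  \sum_(tau < n) h (t%:Z - tau%:Z) - zpsum h N =
  - \sum_(j <- zrange N | leaves n t j) h j.
Proof.
move=> nN; rewrite zpsumE (bigID (leaves n t))/= opprD addrA addrAC.
suff -> : \sum_(j <- zrange N | ~~ leaves n t j) h j =
    \sum_(tau < n) h (t%:Z - tau%:Z) by rewrite subrr add0r.
rewrite -(big_iota (fun tau : nat => h (t%:Z - tau%:Z))) -big_filter.
have -> : \sum_(tau <- iota 0 n) h (t%:Z - tau%:Z) =
    \sum_(j <- [seq t%:Z - tau%:Z | tau <- iota 0 n]) h j by rewrite big_map.
have tn := ltn_ord t.
apply: perm_big; apply: uniq_perm; rewrite ?filter_uniq ?zrange_uniq//.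
  by rewrite map_inj_uniq ?iota_uniq// => i j; lia.
move=> j; rewrite mem_filter mem_zrange /leaves; apply/idP/mapP.
  by move=> H; exists (absz (t%:Z - j)); rewrite ?mem_iota; lia.
by move=> [k + ->]; rewrite mem_iota; lia.
Qed.

(** The price of summing over all lags instead of those inside the window.
    Exchanging the summations over times and lags, the lag j is paid at most |j|
    times. *)
Lemma Gamma_tail n (a b : 'I_p) om (q : 'I_n -> R[i]) : (0 < n)%N ->
  (forall t, `|q t| = 1) ->
  `|\sum_(t < n) q t * (\sum_(tau < n)
      (Dlim (t%:Z - tau%:Z) (t.+1%:R / n%:R) a b)%:C *
        expi (- ((t%:Z - tau%:Z)%:~R * om))
     - Gamma Dlim a b (t.+1%:R / n%:R) om)| <= (S + S)%:C.
Proof.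
move=> n0 q1.
have n0' : 0 < n%:R :> R by rewrite ltr0n.
have u01 (t : 'I_n) : 0 <= (t.+1%:R / n%:R : R) <= 1.
  by rewrite divr_ge0//= ler_pdivrMr// mul1r ler_nat.
pose h (t : 'I_n) (j : int) := (Dlim j (t.+1%:R / n%:R) a b)%:C * expi (- (j%:~R * om)).
apply: (@ccvg_norm_le _ (fun N => \sum_(t < n) q t *
   (\sum_(tau < n) h t (t%:Z - tau%:Z) - zpsum (h t) N)) _ _ n).
  apply: ccvg_sum => t; apply: ccvgMl; apply: ccvgB; first exact: ccvg_cst.
  exact: Gamma_ccvg.
move=> N nN; rewrite (le_trans (ler_norm_sum _ _ _))//.
apply: (@le_trans _ _ (\sum_(t < n) \sum_(j <- zrange N | leaves n t j) (w j)%:C)).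
  apply: ler_sum => t _; rewrite normrM q1 mul1r zpsum_window// normrN.
  rewrite (le_trans (ler_norm_sum _ _ _))//; apply: ler_sum => j _.
  by rewrite normrM norm_expi mulr1 norm_realc lecR (weight_bound W).
under eq_bigr do rewrite -rmorph_sum/=.
rewrite -rmorph_sum/= lecR; under eq_bigr do rewrite big_mkcond.
rewrite exchange_big/=; apply: le_trans (weight_sum W (zrange_uniq N)).
apply: ler_sum => j _.
rewrite (eq_bigr (fun t : 'I_n => (leaves n t j)%:R * w j)); last first.
  by move=> t _; case: leaves; rewrite ?mul1r ?mul0r.
rewrite -mulr_suml ler_wpM2r ?(weight_ge0 W)// -natr_sum.
apply: (@le_trans _ _ `|j|%:~R); last by rewrite lerDr.
by rewrite pmulrn ler_int -abszE lez_nat count_leaves.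
Qed.

(** Two errors of order 1/n: that of the local approximation, and that of moving
    the midpoint (t + tau) / 2n to t / n. *)
Lemma local_error n (a b : 'I_p) (t : 'I_n) : (0 < n)%N ->
  \sum_(tau < n) `|D n t.+1%:Z tau.+1%:Z a b
     - Dlim (t%:Z - tau%:Z) (t.+1%:R / n%:R) a b| <= (M + 1) * S / n%:R.
Proof.
move=> n0; have n0' : 0 < n%:R :> R by rewrite ltr0n.
have ur : uniq [seq t%:Z - tau%:Z | tau <- iota 0 n].
  by rewrite map_inj_uniq ?iota_uniq// => i j; lia.
have := weight_sum W ur; rewrite big_map big_iota => wS.
rewrite mulrAC; apply: le_trans (ler_wpM2l _ wS); last first.
  by rewrite divr_ge0// addr_ge0// (weight_approx_ge0 W).
rewrite mulr_sumr; apply: ler_sum => tau _.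
have jE : t.+1%:Z - tau.+1%:Z = t%:Z - tau%:Z by lia.
have := weight_approx W t.+1%:Z tau.+1%:Z a b n0; rewrite jE => H1.
have H2 := weight_lipschitz W (t%:Z - tau%:Z)
  ((t.+1%:Z + tau.+1%:Z)%:~R / (2 * n%:R)) (t.+1%:R / n%:R) a b.
set w0 := w _ in H1 H2 *; have w00 : 0 <= w0 by exact: weight_ge0 W _.
have uE : `|(t.+1%:Z + tau.+1%:Z)%:~R / (2 * n%:R) - t.+1%:R / n%:R| <=
    `|t%:Z - tau%:Z|%:~R / n%:R :> R.
  have -> : (t.+1%:Z + tau.+1%:Z)%:~R / (2 * n%:R) - t.+1%:R / n%:R =
     - (t%:Z - tau%:Z)%:~R / (2 * n%:R) :> R.
    rewrite -jE !rmorphD/= rmorphN/= -!pmulrn; field; exact: lt0r_neq0.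
  rewrite normrM normrN normfV (@gtr0_norm _ (2 * n%:R)) ?mulr_gt0// -intr_norm ler_wpM2l//.
  by rewrite lef_pV2 ?posrE ?mulr_gt0// (ler_peMl (ltW n0'))// ler1n.
rewrite (le_trans (ler_distD
  (Dlim (t%:Z - tau%:Z) ((t.+1%:Z + tau.+1%:Z)%:~R / (2 * n%:R)) a b) _ _))//.
apply: le_trans (lerD H1 (le_trans H2 (ler_wpM2r w00 uE))) _.
rewrite -mulrDl mulrA ler_wpM2r// -mulrDl [leRHS]mulrAC ler_wpM2r ?invr_ge0//.
have -> (J : R) : (M + 1) * (1 + J) = M + J + (M * J + 1) by ring.
by rewrite lerDl addr_ge0// mulr_ge0// ?(weight_approx_ge0 W)// ler0z.
Qed.

(** Write exp(-i t om1 + i tau om2) as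
    exp(-i t (om1 - om2)) exp(-i (t - tau) om2): the inner sum over tau is then a
    partial sum of the Fourier series of Gamma at t / n. *)
Lemma dft_inverse_covariance n (a b : 'I_p) (om1 om2 : R) : (0 < n)%N ->
  `|\sum_(t < n) \sum_(tau < n) expi (- (t.+1%:R * om1)) *
        (D n t.+1%:Z tau.+1%:Z a b)%:C * expi (tau.+1%:R * om2)
    - \sum_(t < n) expi (- (t.+1%:R * (om1 - om2))) *
        Gamma Dlim a b (t.+1%:R / n%:R) om2| <= ((M + 1) * S + (S + S))%:C.
Proof.
move=> n0; have n0' : 0 < n%:R :> R by rewrite ltr0n.
pose q (t : 'I_n) := expi (- (t.+1%:R * (om1 - om2))) : R[i].
pose h (t tau : 'I_n) := expi (- ((t%:Z - tau%:Z)%:~R * om2)) : R[i].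
have qh (t tau : 'I_n) : expi (- (t.+1%:R * om1)) * expi (tau.+1%:R * om2) = q t * h t tau.
  rewrite -!expiD; congr expi; rewrite rmorphB/= -!pmulrn -!natr1; ring.
have -> : \sum_(t < n) \sum_(tau < n) expi (- (t.+1%:R * om1)) *
        (D n t.+1%:Z tau.+1%:Z a b)%:C * expi (tau.+1%:R * om2)
    - \sum_(t < n) expi (- (t.+1%:R * (om1 - om2))) *
        Gamma Dlim a b (t.+1%:R / n%:R) om2 =
  \sum_(t < n) q t * (\sum_(tau < n) (D n t.+1%:Z tau.+1%:Z a b -
     Dlim (t%:Z - tau%:Z) (t.+1%:R / n%:R) a b)%:C * h t tau) +
  \sum_(t < n) q t * (\sum_(tau < n)
      (Dlim (t%:Z - tau%:Z) (t.+1%:R / n%:R) a b)%:C * h t tau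
     - Gamma Dlim a b (t.+1%:R / n%:R) om2).
  rewrite -big_split -sumrB/=; apply: eq_bigr => t _.
  rewrite -mulrDr addrA -big_split/= [RHS]mulrBr; congr (_ - _).
  rewrite mulr_sumr; apply: eq_bigr => tau _.
  by rewrite -mulrDl -rmorphD/= subrK mulrAC qh; ring.
rewrite rmorphD/= (le_trans (ler_normD _ _))// lerD//; last first.
  by apply: Gamma_tail => // t; rewrite norm_expi.
rewrite (le_trans (ler_norm_sum _ _ _))//.
apply: (@le_trans _ _ (\sum_(t < n) ((M + 1) * S / n%:R)%:C)).
  apply: ler_sum => t _; rewrite normrM norm_expi mul1r.
  rewrite (le_trans (ler_norm_sum _ _ _))//.
  under eq_bigr do rewrite normrM norm_expi mulr1 norm_realc.
  by rewrite -rmorph_sum/= lecR local_error.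
by rewrite -rmorph_sum/= sumr_const card_ord -[_ *+ n]mulr_natr divfK ?gt_eqF.
Qed.

End LocalApproximation.

(** * The discrete Fourier transform of a sample *)

Section DiscreteFourier.
Local Open Scope sesquilinear_scope.
Context (R : realType).

Lemma conjcM (x y : R[i]) : (x * y)^*%C = x^*%C * y^*%C.
Proof. exact: rmorphM. Qed.

Lemma conjc_sum I (s : seq I) (F : I -> R[i]) :
  (\sum_(i <- s) F i)^*%C = \sum_(i <- s) (F i)^*%C.
Proof. exact: rmorph_sum. Qed.

Lemma adjointE m n (A : 'M[R[i]]_(m, n)) i j : (A^t*) i j = (A j i)^*%C.
Proof. by rewrite !mxE. Qed.

Lemma expi_natmul (x : R) m : expi (m%:R * x) = expi x ^+ m.
Proof.
elim: m => [|m IH]; first by rewrite mul0r expi0 expr0.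
by rewrite -natr1 mulrDl mul1r expiD IH exprSr.
Qed.

Lemma cos_neq1 (x : R) : 0 < `|x| < 2 * pi -> cos x != 1.
Proof.
have H (y : R) : 0 < y < 2 * pi -> cos y != 1.
  move=> /andP[y0 y2]; apply/eqP => cy.
  have : sin (y / 2) ^+ 2 = 0.
    have := cosD (y / 2) (y / 2); rewrite -splitr cy.
    have := cos2Dsin2 (y / 2); rewrite !expr2; lra.
  have : 0 < sin (y / 2) by apply: sin_gt0_pi; lra.
  by move=> /[swap] /eqP; rewrite sqrf_eq0 => /eqP ->; rewrite ltxx.
have [x0|x0] := leP 0 x; first by rewrite ger0_norm//; exact: H.
by rewrite ltr0_norm// -cosN; exact: H.
Qed.

Lemma sum_expi (x : R) n : expi (n%:R * x) = 1 -> cos x != 1 ->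
  \sum_(t < n) expi (t.+1%:R * x) = 0.
Proof.
move=> xn x1; have z1 : expi x - 1 != 0.
  by rewrite subr_eq0 eq_complex/= negb_and x1.
apply: (mulfI z1); rewrite mulr0.
under eq_bigr do rewrite expi_natmul exprS.
rewrite -mulr_sumr mulrCA -subrX1 -expi_natmul xn subrr mulr0.
by [].
Qed.

Lemma omegaB n (k l : 'I_n) :
  omega R k - omega R l = 2 * pi * (k%:Z - l%:Z)%:~R / n%:R.
Proof.
by rewrite /omega rmorphB/= -!pmulrn -[k.+1%:R]natr1 -[l.+1%:R]natr1; ring.
Qed.

Lemma dft_adjointM n : (dft R n)^t* *m dft R n = 1%:M.
Proof.
apply/matrixP => k l; rewrite !mxE.
have n0 : (0 < n)%N by apply: leq_ltn_trans (ltn_ord k).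
have n0' : 0 < n%:R :> R by rewrite ltr0n.
have nn0 := lt0r_neq0 n0'.
have sqn : (Num.sqrt n%:R)^-1 * (Num.sqrt n%:R)^-1 = n%:R^-1 :> R.
  by rewrite -invfM -expr2 sqr_sqrtr// ltW.
have -> : \sum_(j < n) (dft R n)^t* k j * dft R n j l =
   (n%:R^-1)%:C * \sum_(j < n) expi (j.+1%:R * (omega R l - omega R k)).
  rewrite mulr_sumr; apply: eq_bigr => j _; rewrite !mxE.
  rewrite -[Num.conj _]/((_)^*%C) conjcM conj_expi conjc_real mulrACA.
  rewrite -(rmorphM (real_complex R))/= sqn -expiD; congr (_ * expi _); ring.
have [->|kl] := eqVneq k l.
  under eq_bigr do rewrite subrr mulr0 expi0.
  by rewrite sumr_const card_ord -(rmorph_nat (real_complex R)) -rmorphM/= mulVf.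
rewrite sum_expi ?mulr0// omegaB//.
  have -> : n%:R * (2 * pi * (l%:Z - k%:Z)%:~R / n%:R) = 2 * pi * (l%:Z - k%:Z)%:~R :> R.
    by field.
  have [lk|lk] := leqP k l.
    by rewrite subzn// -pmulrn -[2 * pi * _]add0r expi_periodic expi0.
  rewrite -(expi_periodic _ (k - l)) -mulrDr [(k - l)%:R]pmulrn -subzn ?(ltnW lk)//.
  by rewrite -rmorphD/= addrA subrK subrr mulr0z mulr0 expi0.
apply: cos_neq1.
have pi0 := pi_gt0 R.
have -> : `|2 * pi * (l%:Z - k%:Z)%:~R / n%:R| =
    2 * pi * `|(l%:Z - k%:Z)%:~R| / n%:R :> R.
  by rewrite 2!normrM normfV (gtr0_norm n0') (@gtr0_norm _ (2 * pi)) ?mulr_gt0.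
have d0 : 0 < `|(l%:Z - k%:Z)%:~R| :> R.
  by rewrite normr_gt0 intr_eq0 subr_eq0 eqz_nat eq_sym.
have dn : `|(l%:Z - k%:Z)%:~R| < n%:R :> R.
  rewrite -intr_norm pmulrn ltr_int.
  by have := ltn_ord k; have := ltn_ord l; lia.
apply/andP; split; first by rewrite !mulr_gt0// invr_gt0.
by rewrite -mulrA gtr_pMr ?mulr_gt0// ltr_pdivrMr// mul1r.
Qed.

Definition block_idx p n (k : 'I_(\sum_(a < p) n)) : 'I_p * 'I_n :=
  (tagnat.sig1 k, tagnat.sig2 k).
Definition block_rank p n (a : 'I_p) (i : 'I_n) : 'I_(\sum_(a < p) n) :=
  @tagnat.Rank p (fun=> n) a i.

Lemma block_idxK p n : cancel (@block_idx p n) (fun q => block_rank q.1 q.2).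
Proof. by move=> k; exact: tagnat.sig2K. Qed.

Lemma block_rankK p n : cancel (fun q => block_rank q.1 q.2) (@block_idx p n).
Proof.
move=> [a i]; rewrite /block_idx /block_rank/= tagnat.Rank1K; congr (_, _).
by apply: val_inj; rewrite /= tagnat.Rank2K.
Qed.

Lemma block_idx_rank p n (a : 'I_p) (i : 'I_n) : block_idx (block_rank a i) = (a, i).
Proof. exact: (block_rankK (a, i)). Qed.

Lemma block_idx_bij p n : bijective (@block_idx p n).
Proof. exact: Bijective (@block_idxK p n) (@block_rankK p n). Qed.

Lemma block_sum (V : nmodType) p n (F : 'I_(\sum_(a < p) n) -> V) :
  \sum_k F k = \sum_(a < p) \sum_(i < n) F (block_rank a i).
Proof.
rewrite pair_big/= (reindex (@block_idx p n))/=.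
  by apply: eq_bigr => k _; rewrite block_idxK.
exact/onW_bij/block_idx_bij.
Qed.

Lemma block_sum_row (V : nmodType) p n (F : 'I_(\sum_(a < p) n) -> V) (a : 'I_p) :
  (forall c i, c != a -> F (block_rank c i) = 0) ->
  \sum_k F k = \sum_(i < n) F (block_rank a i).
Proof.
move=> F0; rewrite block_sum (bigD1 a)//= [X in _ + X]big1 ?addr0// => c ca.
by rewrite big1// => i _; exact: F0.
Qed.

Lemma dft_blockE p n (a b : 'I_p) (i j : 'I_n) :
  dft_block R p n (block_rank a i) (block_rank b j) = if a == b then dft R n i j else 0.
Proof.
have E (k l : 'I_(\sum_(a < p) n)) : dft_block R p n k l =
    if (block_idx k).1 == (block_idx l).1
    then dft R n (block_idx k).2 (block_idx l).2 else 0.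
  rewrite /dft_block /mxdiag !mxE /block_idx/=.
  by case: eqP => _; rewrite ?conform_mx_id// mxE.
by rewrite E !block_idx_rank.
Qed.

Lemma dft_block_adjointM p n : (dft_block R p n)^t* *m dft_block R p n = 1%:M.
Proof.
apply/matrixP => k l; rewrite -(block_idxK k) -(block_idxK l).
case: (block_idx k) (block_idx l) => [a i] [b j] /=.
rewrite mxE [RHS]mxE (@block_sum_row _ p n _ a); last first.
  by move=> c t /negPf ca; rewrite adjointE dft_blockE ca conjc0 mul0r.
rewrite (eq_bigr (fun t => (dft R n t i)^*%C * (if a == b then dft R n t j else 0)));
  last by move=> t _; rewrite adjointE !dft_blockE eqxx.
have -> : (block_rank a i == block_rank b j) = (a == b) && (i == j).
  by rewrite -(can_eq (@block_idxK p n)) !block_idx_rank.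
have [_|_] := eqVneq a b; last by rewrite big1// => t _; rewrite mulr0.
have /matrixP /(_ i j) := dft_adjointM n.
by rewrite mxE [RHS]mxE/= => <-; apply: eq_bigr => t _; rewrite adjointE.
Qed.

Lemma adjoint_similar_inv m (A : 'M[R]_m) (F : 'M[R[i]]_m) :
  A \in unitmx -> F^t* *m F = 1%:M ->
  invmx (F^t* *m map_mx (real_complex R) A *m F) =
  F^t* *m map_mx (real_complex R) (invmx A) *m F.
Proof.
move=> Au F1.
have inv_uniq (B C : 'M[R[i]]_m) : C *m B = 1%:M -> invmx B = C.
  move=> CB; have [_ Bu] := mulmx1_unit CB.
  by rewrite -[LHS]mul1mx -CB mulmxK.
apply: inv_uniq.
have AiA : map_mx (real_complex R) (invmx A) *m map_mx (real_complex R) A = 1%:M.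
  by rewrite -map_mxM mulVmx// map_mx1.
move: (map_mx _ (invmx A)) (map_mx _ A) AiA => Ai Ac AiA.
by rewrite !mulmxA -(mulmxA _ F) (mulmx1C F1) mulmx1 -(mulmxA _ Ai) AiA mulmx1.
Qed.

End DiscreteFourier.

(** * Variance of the transformed sample *)

Section SampleVariance.
Local Open Scope sesquilinear_scope.
Context (R : realType) (p : nat) d (T : measurableType d) (P : probability T R).

Definition integrablec (f : T -> R[i]) :=
  ((fun w => complex.Re (f w)) \in Lfun P 1) /\ ((fun w => complex.Im (f w)) \in Lfun P 1).

Lemma cexpectD f g : integrablec f -> integrablec g ->
  integrablec (fun w => f w + g w) /\
  cexpect P (fun w => f w + g w) = cexpect P f + cexpect P g.
Proof.
move=> [fR fI] [gR gI].
have RE : (fun w => complex.Re (f w + g w)) =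
      (fun w => complex.Re (f w)) \+ (fun w => complex.Re (g w)).
  by apply/funext => w /=; rewrite ReD.
have IE : (fun w => complex.Im (f w + g w)) =
      (fun w => complex.Im (f w)) \+ (fun w => complex.Im (g w)).
  by apply/funext => w /=; rewrite ImD.
split; first by split; rewrite ?RE ?IE rpredD.
by rewrite /cexpect RE IE !expectationD// !fineD ?expectation_fin_num.
Qed.

Lemma cexpectZ (c : R[i]) (Y : T -> R) : Y \in Lfun P 1 ->
  integrablec (fun w => c * (Y w)%:C) /\
  cexpect P (fun w => c * (Y w)%:C) = c * (fine 'E_P[Y])%:C.
Proof.
move=> Y1.
have RE : (fun w => complex.Re (c * (Y w)%:C)) = complex.Re c \o* Y.
  by apply/funext => w /=; rewrite ReM/= mulr0 subr0 mulrC.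
have IE : (fun w => complex.Im (c * (Y w)%:C)) = complex.Im c \o* Y.
  by apply/funext => w /=; rewrite ImM/= mulr0 add0r mulrC.
split; first by split; rewrite ?RE ?IE; apply: Lfun_scale.
rewrite /cexpect RE IE !expectationZl// !fineM ?expectation_fin_num//=.
by apply/eqP; rewrite eq_complex ReM ImM/= !mulr0 subr0 add0r !eqxx.
Qed.

Lemma cexpect_sum (I : Type) (s : seq I) (c : I -> R[i]) (Y : I -> T -> R) :
  (forall i, Y i \in Lfun P 1) ->
  integrablec (fun w => \sum_(i <- s) c i * (Y i w)%:C) /\
  cexpect P (fun w => \sum_(i <- s) c i * (Y i w)%:C) =
    \sum_(i <- s) c i * (fine 'E_P[Y i])%:C.
Proof.
move=> Y1; elim: s => [|i s [IH1 IH2]].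
  have [H1 H2] := cexpectZ 0 (Lfun_cst P 0 1).
  rewrite big_nil (_ : (fun w => _) = (fun w => 0 * (cst 0 w : R)%:C)).
    by rewrite H2 mul0r.
  by apply/funext => w; rewrite big_nil mul0r.
have [H1 H2] := cexpectZ (c i) (Y1 i).
have [H3 H4] := cexpectD H1 IH1.
have -> : (fun w => \sum_(j <- i :: s) c j * (Y j w)%:C) =
   (fun w => c i * (Y i w)%:C + \sum_(j <- s) c j * (Y j w)%:C).
  by apply/funext => w; rewrite big_cons.
by split; [exact: H3|rewrite H4 H2 IH2 big_cons].
Qed.

Context (X : int -> 'I_p -> {RV P >-> R}) (hX : centred_L2 X).

Lemma cvar_sample n :
  cvar P (fun w => (dft_block R p n)^t* *m sample n X w) =
  (dft_block R p n)^t* *m map_mx (real_complex R) (gram X (@block_idx p n))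
    *m dft_block R p n.
Proof.
apply/matrixP => k l; rewrite !mxE.
set F := dft_block R p n.
pose xi (i : 'I_(\sum_(a < p) n)) := X (block_idx i).2.+1%:Z (block_idx i).1 : T -> R.
pose c (q : 'I_(\sum_(a < p) n) * 'I_(\sum_(a < p) n)) := F^t* k q.1 * F q.2 l.
pose Y (q : 'I_(\sum_(a < p) n) * 'I_(\sum_(a < p) n)) := (xi q.1 \* xi q.2)%R : T -> R.
have Y1 q : Y q \in Lfun P 1.
  exact: (L2_mul_Lfun1 (vX hX (block_idx q.1).2.+1%:Z (block_idx q.1).1)
    (vX hX (block_idx q.2).2.+1%:Z (block_idx q.2).1)).
have [_ H] := cexpect_sum (index_enum _) c Y1.
transitivity (cexpect P (fun w => \sum_q c q * (Y q w)%:C)).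
  congr cexpect; apply/funext => w; rewrite !mxE big_ord1.
  have sE j : sample n X w j 0 = (xi j w)%:C by rewrite !mxE.
  have ZE i : (F^t* *m sample n X w) i 0 = \sum_j F^t* i j * (xi j w)%:C.
    by rewrite mxE; apply: eq_bigr => j _; rewrite sE.
  rewrite ZE [((F^t* *m sample n X w)^t*) 0 l]mxE [(_^T) 0 l]mxE ZE.
  rewrite -[Num.conj _]/((_)^*%C) conjc_sum mulr_suml.
  rewrite [RHS](eq_bigr (fun q => c (q.1, q.2) * (Y (q.1, q.2) w)%:C)); last by case.
  rewrite -(pair_bigA _ (fun i j => c (i, j) * (Y (i, j) w)%:C))/=.
  apply: eq_bigr => i _; rewrite mulr_sumr; apply: eq_bigr => j _.
  rewrite conjcM conjc_real /c /Y/= rmorphM/=.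
  have -> : conjc (F^t* l j) = F j l by rewrite !mxE; exact: conjcK.
  by rewrite mulrACA.
rewrite H [LHS](eq_bigr (fun q => c (q.1, q.2) * (fine 'E_P[Y (q.1, q.2)])%:C)); last by case.
rewrite -(pair_bigA _ (fun i j => c (i, j) * (fine 'E_P[Y (i, j)])%:C))/= exchange_big/=.
apply: eq_bigr => j _; rewrite [X in _ = X * _]mxE mulr_suml; apply: eq_bigr => i _.
rewrite /c/= mulrAC; congr (_ * _ * _).
by rewrite 2!mxE (covmxE hX).
Qed.

(** Since the transform is unitary, K_n is the transform of the inverse of the
    real Gram matrix; the two normalisations 1/sqrt n give the factor 1/n. *)
Lemma KentryE n (a b : 'I_p) (k1 k2 : 'I_n) : gram X (@block_idx p n) \in unitmx ->
  Kentry X a b k1 k2 = n%:R^-1 * \sum_(t < n) \sum_(tau < n)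
    expi (- (t.+1%:R * omega R k1)) *
    (invmx (gram X (@block_idx p n)) (block_rank a t) (block_rank b tau))%:C *
    expi (tau.+1%:R * omega R k2).
Proof.
move=> Gu; rewrite /Kentry /Kmx cvar_sample adjoint_similar_inv//; last first.
  exact: dft_block_adjointM.
set G := invmx _; rewrite mxE -/(block_rank a k1) -/(block_rank b k2).
have sqn : (Num.sqrt n%:R)^-1 * (Num.sqrt n%:R)^-1 = n%:R^-1 :> R.
  by rewrite -invfM -expr2 sqr_sqrtr.
have E i : (dft_block R p n)^t* (block_rank a k1) i =
  conjc (dft_block R p n i (block_rank a k1)) by rewrite !mxE.
rewrite mxE (@block_sum_row _ p n _ b); last first.
  by move=> c i /negPf cb; rewrite dft_blockE cb mulr0.
rewrite exchange_big/= mulr_sumr; apply: eq_bigr => tau _.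
rewrite mxE (@block_sum_row _ p n _ a); last first.
  by move=> c i /negPf ca; rewrite E dft_blockE ca conjc0 mul0r.
rewrite mulr_suml mulr_sumr; apply: eq_bigr => t _.
rewrite E !dft_blockE !eqxx !mxE.
rewrite conjcM conjc_real conj_expi.
have -> : (n%:R^-1 : R[i]) = (n%:R^-1 : R)%:C by rewrite fmorphV rmorph_nat.
by rewrite -sqn rmorphM/=; ring.
Qed.

(** K_n is Hermitian, because the Gram matrix is real and symmetric. *)
Lemma Kentry_conj n (a b : 'I_p) (k1 k2 : 'I_n) : gram X (@block_idx p n) \in unitmx ->
  Kentry X a b k1 k2 = (Kentry X b a k2 k1)^*%C.
Proof.
move=> Gu; rewrite !KentryE// conjcM fmorphV rmorph_nat; congr (_ * _).
rewrite conjc_sum exchange_big/=; apply: eq_bigr => tau _.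
rewrite conjc_sum; apply: eq_bigr => t _.
rewrite !conjcM !conj_expi opprK conjc_real mulrAC mulrC.
rewrite [in RHS]mulrAC -[RHS]mulrA [in RHS]mulrC.
have Gs : (invmx (gram X (@block_idx p n)))^T = invmx (gram X (@block_idx p n)).
  rewrite trmx_inv; congr invmx; apply/matrixP => i j.
  by rewrite !mxE !(covariance_vX hX (vX hX _ _)) dotEC.
by rewrite -{1}Gs mxE; ring.
Qed.

End SampleVariance.

(** * Fourier coefficients of the local spectral matrix *)

Section FourierCoefficients.
Context (R : realType) (p : nat).
Context (D : nat -> int -> int -> 'M[R]_p) (Dlim : int -> R -> 'M[R]_p)
  (w : int -> R) (S M : R) (W : stationary_weights D Dlim w S M).
Local Notation mu := (@lebesgue_measure R).

(** The real and imaginary parts of Gamma are the cases where [c] is a cosine or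
    a sine. *)
Lemma series_lipschitz a b (c : int -> R) : (forall j, `|c j| <= 1) ->
  let f u := zsum (fun j => Dlim j u a b * c j) in
  `|f 1| <= S /\ (forall u v, `|f u - f v| <= S * `|u - v|).
Proof.
move=> c1 f; have w0 := weight_ge0 W; have wS := weight_sum1 W.
have Dc j u x : 0 <= x -> `|Dlim j u a b| <= x -> `|Dlim j u a b * c j| <= x.
  by move=> x0 ux; rewrite normrM -[leRHS]mulr1 ler_pM.
have Db j u : `|Dlim j u a b| <= (1 + `|u|) * w j.
  rewrite -(subrK (Dlim j 0 a b) (Dlim j u a b)) (le_trans (ler_normD _ _))//.
  rewrite mulrDl mul1r addrC lerD ?(weight_bound W) ?lexx ?ler01//.
  by have := weight_lipschitz W j u 0 a b; rewrite subr0.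
split.
  apply: zsum_le wS => j; apply: Dc => //.
  by apply: (weight_bound W); rewrite ler01 lexx.
move=> u v; rewrite /f -(@zsumB _ _ _ (fun j => (1 + `|u| + `|v|) * w j)
  ((1 + `|u| + `|v|) * S)).
- apply: (@zsum_le _ _ (fun j => `|u - v| * w j)) => [j|r ur].
    by rewrite -mulrBl normrM -[leRHS]mulr1 ler_pM// (weight_lipschitz W).
  by rewrite -mulr_sumr mulrC ler_wpM2r ?wS.
- move=> j; apply: Dc; first by rewrite mulr_ge0// !addr_ge0.
  by rewrite (le_trans (Db j u))// ler_wpM2r// lerDl.
- move=> j; apply: Dc; first by rewrite mulr_ge0// !addr_ge0.
  by rewrite (le_trans (Db j v))// ler_wpM2r// lerD2r lerDl.
by move=> r ur; rewrite -mulr_sumr ler_wpM2l ?wS// !addr_ge0.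
Qed.

Lemma Gamma_ReIm a b om :
  (forall u, complex.Re (Gamma Dlim a b u om) =
     zsum (fun j => Dlim j u a b * cos (- (j%:~R * om)))) /\
  (forall u, complex.Im (Gamma Dlim a b u om) =
     zsum (fun j => Dlim j u a b * sin (- (j%:~R * om)))).
Proof.
split=> u; rewrite /Gamma /czsum/=; congr zsum; apply/funext => j.
  by rewrite mul0r subr0.
by rewrite mul0r addr0.
Qed.

(** Real and imaginary parts of the integrand are sums of two products to which
    [riemann_sum_cos] applies, the sine being the cosine shifted by - pi / 2;
    each of the four errors is at most 5 S / n. *)
Lemma riemann_Gamma n a b om (r : int) : (0 < n)%N -> `|r|%:~R <= n%:R / 2 :> R ->
  `|n%:R^-1 * \sum_(t < n) expi (- (2 * pi * r%:~R * t.+1%:R / n%:R)) *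
        Gamma Dlim a b (t.+1%:R / n%:R) om - Kcoef Dlim a b r om|
  <= (20 * S / n%:R)%:C.
Proof.
move=> n0 rn.
have [GR GI] := Gamma_ReIm a b om.
pose f1 u := complex.Re (Gamma Dlim a b u om).
pose f2 u := complex.Im (Gamma Dlim a b u om).
have [f1b f1L] : `|f1 1| <= S /\ (forall u v, `|f1 u - f1 v| <= S * `|u - v|).
  rewrite /f1; split=> [|u v]; rewrite !GR.
    exact: (series_lipschitz a b (fun j => cos_max _)).1.
  exact: (series_lipschitz a b (fun j => cos_max _)).2.
have [f2b f2L] : `|f2 1| <= S /\ (forall u v, `|f2 u - f2 v| <= S * `|u - v|).
  rewrite /f2; split=> [|u v]; rewrite !GI.
    exact: (series_lipschitz a b (fun j => sin_max _)).1.
  exact: (series_lipschitz a b (fun j => sin_max _)).2.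
pose g phi (u : R) := cos (2 * pi * r%:~R * u + phi).
have gc phi : continuous (g phi).
  move=> u; apply: continuous_comp; last exact: continuous_cos.
  apply: cvgD; last exact: cvg_cst.
  by apply: cvgM; [exact: cvg_cst|exact: cvg_id].
have int_fg (f : R -> R) phi : (forall u v, `|f u - f v| <= S * `|u - v|) ->
    mu.-integrable `[0, 1] (EFin \o (fun u => f u * g phi u)).
  move=> fL; apply: integrable_itv => x; apply: cvgM; last exact: gc.
  exact: (lipschitz_continuous fL).
pose err (f : R -> R) phi := n%:R^-1 * \sum_(t < n) f (t.+1%:R / n%:R) * g phi (t.+1%:R / n%:R)
    - (\int[mu]_(u in `[0, 1]) (f u * g phi u))%R.
have errb (f : R -> R) phi : `|f 1| <= S -> (forall u v, `|f u - f v| <= S * `|u - v|) ->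
    `|err f phi| <= 5 * S / n%:R.
  move=> fS fL; have -> : 5 * S = 2 * S + 3 * S by ring.
  exact: riemann_sum_cos.
have ReE u : complex.Re (expi (- (2 * pi * r%:~R * u)) * Gamma Dlim a b u om) =
    f1 u * g 0 u + f2 u * g (- (pi / 2)) u.
  rewrite ReM Re_expi Im_expi /g addr0 cosBpihalf cosN sinN /f1 /f2; ring.
have ImE u : complex.Im (expi (- (2 * pi * r%:~R * u)) * Gamma Dlim a b u om) =
    f2 u * g 0 u - f1 u * g (- (pi / 2)) u.
  rewrite ImM Re_expi Im_expi /g addr0 cosBpihalf cosN sinN /f1 /f2; ring.
have nC : (n%:R^-1 : R[i]) = (n%:R^-1 : R)%:C by rewrite fmorphV rmorph_nat.
have ReB (x y : R[i]) : complex.Re (x - y) = complex.Re x - complex.Re y.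
  by case: x y => [? ?] [? ?].
have ImB (x y : R[i]) : complex.Im (x - y) = complex.Im x - complex.Im y.
  by case: x y => [? ?] [? ?].
have -> : 20 * S / n%:R = (5 * S / n%:R + 5 * S / n%:R) + (5 * S / n%:R + 5 * S / n%:R) by ring.
rewrite nC; under eq_bigr do rewrite -(mulrA (2 * pi * r%:~R)).
have ReC (x : R) (z : R[i]) : complex.Re (x%:C * z) = x * complex.Re z.
  by case: z => ? ? /=; rewrite mul0r subr0.
have ImC (x : R) (z : R[i]) : complex.Im (x%:C * z) = x * complex.Im z.
  by case: z => ? ? /=; rewrite mul0r addr0.
have KR : complex.Re (Kcoef Dlim a b r om) =
    (\int[mu]_(u in `[0, 1]) (f1 u * g 0 u + f2 u * g (- (pi / 2)) u))%R.
  by apply: eq_Rintegral => u _; exact: ReE.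
have KI : complex.Im (Kcoef Dlim a b r om) =
    (\int[mu]_(u in `[0, 1]) (f2 u * g 0 u - f1 u * g (- (pi / 2)) u))%R.
  by apply: eq_Rintegral => u _; exact: ImE.
apply: normc_le_ReIm.
  rewrite ReB ReC Re_sum KR; under eq_bigr do rewrite ReE.
  rewrite RintegralD//; [|exact: int_fg|exact: int_fg].
  rewrite big_split/= mulrDr opprD addrACA -/(err f1 0) -/(err f2 (- (pi / 2))).
  by rewrite (le_trans (ler_normD _ _))// lerD// errb.
rewrite ImB ImC Im_sum KI; under eq_bigr do rewrite ImE.
rewrite RintegralB//; [|exact: int_fg|exact: int_fg].
rewrite sumrB mulrBr [X in `|X|](_ : _ = err f2 0 - err f1 (- (pi / 2))); last first.
  by rewrite /err; ring.
by rewrite (le_trans (ler_normB _ _))// lerD// errb.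
Qed.

End FourierCoefficients.

(** * From the finite section to the transformed inverse *)

(** For nonzero lags j, |j|^K is at least |j|, so the decay condition bounds the
    first moments of the rows. *)
Lemma weighted_row_bound (R : realType) p (D : int -> int -> 'M[R]_p) (K M : R) :
  3 / 2 <= K ->
  (ereal_sup (range (fun t : int =>
     \esum_(j in [set j : int | j != 0%R])
       ((`|j|%:~R `^ K) * mx_norm (D t (t + j)))%:E)) <= M%:E)%E ->
  forall t (r : seq int), uniq r ->
    \sum_(s <- r) `|s - t|%:~R * mx_norm (D t s) <= M.
Proof.
move=> hK hM t r ur.
have ht : (\esum_(j in [set j : int | j != 0%R])
    ((`|j|%:~R `^ K) * mx_norm (D t (t + j)))%:E <= M%:E)%E.
  by apply: le_trans hM; apply: ereal_sup_ubound; exists t.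
pose r' := [seq s - t | s <- r & s != t].
have ur' : uniq r' by rewrite map_inj_uniq ?filter_uniq//; exact: addIr.
have r'0 : [set` r'] `<=` [set j : int | j != 0%R].
  by move=> _ /= /mapP[s + ->]; rewrite mem_filter subr_eq0 => /andP[].
apply: le_trans (esum_sum_le ht ur' r'0).
rewrite big_map big_filter (bigID (fun s => s != t))/= [X in _ + X]big1 ?addr0; last first.
  by move=> s; rewrite negbK => /eqP ->; rewrite subrr normr0 mulr0z mul0r.
apply: ler_sum => s st; rewrite (addrC t) subrK.
rewrite ler_wpM2r//; first exact: (@normr_ge0 _ _ (D t s)).
have s1 : 1 <= `|s - t|%:~R :> R by rewrite ler1z -gtz0_ge1 normr_gt0 subr_eq0.
rewrite -[leLHS]powRr1 ?(le_trans ler01)// ler_powR//; lra.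
Qed.

Section SpectralInverse.
Context (R : realType) (p : nat) d (T : measurableType d) (P : probability T R).
Context (X : int -> 'I_p -> {RV P >-> R}) (hX : centred_L2 X).
Context (n : nat) (n0 : (0 < n)%N) (D : int -> int -> 'M[R]_p) (B : R).
Local Notation G := (gram X (@block_idx p n)).
Context (Gu : G \in unitmx).
Context (hB : forall x y : 'I_(\sum_(a < p) n) -> R,
  (forall k, `|x k| <= 1) -> (forall k, `|y k| <= 1) ->
  `|\sum_k \sum_l x k *
      (D (block_idx k).2.+1%:Z (block_idx l).2.+1%:Z (block_idx k).1 (block_idx l).1
       - invmx G k l) * y l| <= B).

(** Real and imaginary parts of the transform are combinations of four real
    bilinear forms, whose vectors are cosines and sines carried by the
    components a and b. *)
Lemma Kentry_approx (a b : 'I_p) (k1 k2 : 'I_n) :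
  `|n%:R^-1 * \sum_(t < n) \sum_(tau < n) expi (- (t.+1%:R * omega R k1)) *
        (D t.+1%:Z tau.+1%:Z a b)%:C * expi (tau.+1%:R * omega R k2)
    - Kentry X a b k1 k2| <= (4 * B / n%:R)%:C.
Proof.
have n0' : 0 < n%:R :> R by rewrite ltr0n.
have nC : (n%:R^-1 : R[i]) = (n%:R^-1 : R)%:C by rewrite fmorphV rmorph_nat.
rewrite (KentryE hX)// -mulrBr normrM nC norm_realc (@gtr0_norm R) ?invr_gt0//.
rewrite mulrC (rmorphM (real_complex R) (4 * B)) ler_wpM2r ?ler0c ?invr_ge0// -sumrB.
pose Del (t tau : 'I_n) := D t.+1%:Z tau.+1%:Z a b - invmx G (block_rank a t) (block_rank b tau).
have bil (f g : 'I_n -> R) : (forall t, `|f t| <= 1) -> (forall t, `|g t| <= 1) ->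
    `|\sum_(t < n) \sum_(tau < n) f t * Del t tau * g tau| <= B.
  move=> f1 g1.
  (* f and g, placed on the components a and b of the stacked sample *)
  pose x k := if (@block_idx p n k).1 == a then f (block_idx k).2 else 0.
  pose y k := if (@block_idx p n k).1 == b then g (block_idx k).2 else 0.
  have x1 k : `|x k| <= 1 by rewrite /x; case: ifP; rewrite ?normr0 ?ler01.
  have y1 k : `|y k| <= 1 by rewrite /y; case: ifP; rewrite ?normr0 ?ler01.
  apply: le_trans (hB x1 y1); rewrite le_eqVlt; apply/orP; left; apply/eqP; congr `|_|.
  rewrite (@block_sum_row _ p n _ a); last first.
    move=> c t /negPf ca; rewrite big1// => l _.
    by rewrite /x block_idx_rank ca !mul0r.
  apply: eq_bigr => t _; rewrite (@block_sum_row _ p n _ b); last first.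
    by move=> c tau /negPf cb; rewrite /y (block_idx_rank c) cb mulr0.
  by apply: eq_bigr => tau _; rewrite /x /y !block_idx_rank !eqxx.
rewrite (eq_bigr (fun t : 'I_n => \sum_(tau < n) expi (- (t.+1%:R * omega R k1)) *
   (Del t tau)%:C * expi (tau.+1%:R * omega R k2))); last first.
  by move=> t _; rewrite -sumrB; apply: eq_bigr => tau _; rewrite /Del rmorphB/=; ring.
have -> : 4 * B = (B + B) + (B + B) by ring.
apply: normc_le_ReIm.
  rewrite Re_sum; under eq_bigr do rewrite Re_sum.
  rewrite (_ : \sum_i _ =
     (\sum_(t < n) \sum_(tau < n) cos (t.+1%:R * omega R k1) * Del t tau *
       cos (tau.+1%:R * omega R k2))
   + (\sum_(t < n) \sum_(tau < n) sin (t.+1%:R * omega R k1) * Del t tau *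
       sin (tau.+1%:R * omega R k2))).
    by rewrite (le_trans (ler_normD _ _))// lerD// bil// => t; rewrite ?cos_max ?sin_max.
  rewrite -big_split; apply: eq_bigr => t _; rewrite -big_split; apply: eq_bigr => tau _.
  by rewrite !ReM !ImM/= cosN sinN; ring.
rewrite Im_sum; under eq_bigr do rewrite Im_sum.
rewrite (_ : \sum_i _ =
     (\sum_(t < n) \sum_(tau < n) cos (t.+1%:R * omega R k1) * Del t tau *
       sin (tau.+1%:R * omega R k2))
   - (\sum_(t < n) \sum_(tau < n) sin (t.+1%:R * omega R k1) * Del t tau *
       cos (tau.+1%:R * omega R k2))).
  by rewrite (le_trans (ler_normB _ _))// lerD// bil// => t; rewrite ?cos_max ?sin_max.
rewrite -sumrB; apply: eq_bigr => t _; rewrite -sumrB; apply: eq_bigr => tau _.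
by rewrite !ImM !ReM/= cosN sinN; ring.
Qed.

End SpectralInverse.

(** On the grid, frequencies that differ by n cannot be distinguished. *)
Lemma expi_alias (R : realType) n (r : int) (t : nat) : (0 < n)%N ->
  expi (- (2 * pi * (r - n%:Z)%:~R * t%:R / n%:R)) =
  expi (- (2 * pi * r%:~R * t%:R / n%:R)) :> R[i].
Proof.
move=> n0; have nn0 : n%:R != 0 :> R by rewrite pnatr_eq0 -lt0n.
rewrite -[RHS](expi_periodic _ t); congr expi.
by rewrite rmorphB/= -pmulrn; field.
Qed.

Theorem proposition4p3 (R : realType) (p : nat)
    (d : nat -> measure_display) (T : forall n : nat, measurableType (d n))
    (P : forall n : nat, probability (T n) R)
    (X : forall n : nat, int -> 'I_p -> {RV (P n) >-> R})
    (D : nat -> int -> int -> 'M[R]_p) (Dlim : int -> R -> 'M[R]_p) (K : R)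
    (hp : (0 < p)%N)
    (hX : forall n : nat, (0 < n)%N -> centred_L2 (X n))
    (hvar : forall n : nat, (0 < n)%N ->
      (ereal_sup (range (fun t : int => (mx_norm (covmx (X n) t t))%:E))
         < +oo)%E)
    (hlambda : exists c M : R, 0 < c /\ forall n : nat, (0 < n)%N ->
      (c%:E <= lambda_inf (covmx (X n)))%E /\
      (lambda_sup (covmx (X n)) <= M%:E)%E)
    (hD : forall n : nat, (0 < n)%N -> is_inverse_covariance (X n) (D n))
    (hK : 3 / 2 <= K)
    (hdecay : exists M : R, forall n : nat, (0 < n)%N ->
      (ereal_sup (range (fun t : int =>
         \esum_(j in [set j : int | j != 0%R])
           ((`|j|%:~R `^ K) * mx_norm (D n t (t + j)))%:E)) <= M%:E)%E)
    (hLS : locally_stationary D Dlim) :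
  [/\ exists M : R, forall (n : nat) (a b : 'I_p) (k1 k2 : 'I_n),
        `|Kentry (X n) a b k1 k2
          - (n%:R)^-1 * \sum_(t < n)
              expi (- (2 * pi * (k1%:Z - k2%:Z)%:~R * t.+1%:R / n%:R))
              * Gamma Dlim a b (t.+1%:R / n%:R) (omega R k2)|
        <= (M / n%:R)%:C,
      exists M : R, forall (n : nat) (a b : 'I_p) (k1 k2 : 'I_n),
        let r : int := k1%:Z - k2%:Z in
        [/\ `|r|%:~R <= n%:R / 2 :> R ->
              `|Kentry (X n) a b k1 k2 - Kcoef Dlim a b r (omega R k2)|
              <= (M / n%:R)%:C,
            n%:R / 2 < (r%:~R : R) < n%:R ->
              `|Kentry (X n) a b k1 k2
                - Kcoef Dlim a b (r - n%:Z) (omega R k2)|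
              <= (M / n%:R)%:C &
            - n%:R < (r%:~R : R) < - (n%:R / 2) ->
              `|Kentry (X n) a b k1 k2
                - Kcoef Dlim a b (r + n%:Z) (omega R k2)|
              <= (M / n%:R)%:C] &
      exists M : R, forall (n : nat) (a b : 'I_p) (k1 k2 : 'I_n),
        let r : int := k1%:Z - k2%:Z in
        [/\ `|r|%:~R <= n%:R / 2 :> R ->
              `|Kentry (X n) a b k1 k2
                - (Kcoef Dlim b a (k2%:Z - k1%:Z) (omega R k1))^*%R|
              <= (M / n%:R)%:C,
            n%:R / 2 < (r%:~R : R) < n%:R ->
              `|Kentry (X n) a b k1 k2
                - (Kcoef Dlim b a (k2%:Z - k1%:Z + n%:Z) (omega R k1))^*%R|
              <= (M / n%:R)%:C &
            - n%:R < (r%:~R : R) < - (n%:R / 2) ->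
              `|Kentry (X n) a b k1 k2
                - (Kcoef Dlim b a (k2%:Z - k1%:Z - n%:Z) (omega R k1))^*%R|
              <= (M / n%:R)%:C]].
Proof.
have [lo [hi [lo0 hlam]]] := hlambda; have [Md hdec] := hdecay.
have [w [S [M W]]] := locally_stationary_weights hLS.
have wS := weight_sum1 W.
have S0 : 0 <= S by have := wS [::] isT; rewrite big_nil.
pose B : R := 2 * 1 + 2 * (`|hi| * (4 * p%:R * (p%:R * Md) ^+ 2)).
have inv n (n0 : (0 < n)%N) : (gram (X n) (@block_idx p n) \in unitmx) /\
    forall x y : 'I_(\sum_(a < p) n) -> R,
    (forall k, `|x k| <= 1) -> (forall k, `|y k| <= 1) ->
    `|\sum_k \sum_l x k *
      (D n (block_idx k).2.+1%:Z (block_idx l).2.+1%:Z (block_idx k).1 (block_idx l).1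
       - invmx (gram (X n) (@block_idx p n)) k l) * y l| <= B.
  have [hlo hhi] := hlam n n0.
  have hhi' : (lambda_sup (covmx (X n)) <= `|hi|%:E)%E.
    by rewrite (le_trans hhi)// lee_fin ler_norm.
  split; first exact: (gram_unit (hX n n0) lo0 hlo hhi (@block_idx_bij p n)).
  move=> x y x1 y1.
  apply: (finite_section_inverse (hX n n0) lo0 hlo hhi' (hD n n0)
    (weighted_row_bound hK (hdec n n0)) (normr_ge0 hi) (@block_idx_bij p n)) => //.
pose M1 : R := (M + 1) * S + (S + S) + 4 * B.
have part1 n (a b : 'I_p) (k1 k2 : 'I_n) :
    `|Kentry (X n) a b k1 k2 - (n%:R)^-1 * \sum_(t < n)
        expi (- (2 * pi * (k1%:Z - k2%:Z)%:~R * t.+1%:R / n%:R))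
        * Gamma Dlim a b (t.+1%:R / n%:R) (omega R k2)| <= (M1 / n%:R)%:C.
  have n0 : (0 < n)%N by apply: leq_ltn_trans (ltn_ord k1).
  have n0' : 0 < n%:R :> R by rewrite ltr0n.
  have nC : (n%:R^-1 : R[i]) = (n%:R^-1 : R)%:C by rewrite fmorphV rmorph_nat.
  have [Gu hB] := inv n n0.
  have H1 := Kentry_approx (hX n n0) n0 Gu hB a b k1 k2.
  have H2 := dft_inverse_covariance W a b (omega R k1) (omega R k2) n0.
  rewrite distrC; set A := \sum_(t < n) \sum_(tau < n) _ in H1 H2.
  have <- : \sum_(t < n) expi (- (t.+1%:R * (omega R k1 - omega R k2))) *
        Gamma Dlim a b (t.+1%:R / n%:R) (omega R k2) =
      \sum_(t < n) expi (- (2 * pi * (k1%:Z - k2%:Z)%:~R * t.+1%:R / n%:R))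
        * Gamma Dlim a b (t.+1%:R / n%:R) (omega R k2).
    apply: eq_bigr => t _; rewrite omegaB; congr (expi (- _) * _); ring.
  set Q := \sum_(t < n) _ in H2 *.
  have -> : n%:R^-1 * Q - Kentry (X n) a b k1 k2 =
    - (n%:R^-1 * (A - Q)) + (n%:R^-1 * A - Kentry (X n) a b k1 k2) by ring.
  rewrite /M1 mulrDl rmorphD/= (le_trans (ler_normD _ _))// lerD//.
  rewrite normrN normrM nC norm_realc (@gtr0_norm R) ?invr_gt0//.
  rewrite (mulrC _ n%:R^-1) (rmorphM (real_complex R) n%:R^-1).
  by rewrite ler_wpM2l// ler0c invr_ge0.
have part2 n (a b : 'I_p) (k1 k2 : 'I_n) :
    let r : int := k1%:Z - k2%:Z in
    [/\ `|r|%:~R <= n%:R / 2 :> R ->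
          `|Kentry (X n) a b k1 k2 - Kcoef Dlim a b r (omega R k2)|
          <= ((M1 + 20 * S) / n%:R)%:C,
        n%:R / 2 < (r%:~R : R) < n%:R ->
          `|Kentry (X n) a b k1 k2 - Kcoef Dlim a b (r - n%:Z) (omega R k2)|
          <= ((M1 + 20 * S) / n%:R)%:C &
        - n%:R < (r%:~R : R) < - (n%:R / 2) ->
          `|Kentry (X n) a b k1 k2 - Kcoef Dlim a b (r + n%:Z) (omega R k2)|
          <= ((M1 + 20 * S) / n%:R)%:C].
  move=> r.
  have n0 : (0 < n)%N by apply: leq_ltn_trans (ltn_ord k1).
  have comb (r' : int) : `|r'|%:~R <= n%:R / 2 :> R ->
      (forall t : nat, expi (- (2 * pi * r'%:~R * t%:R / n%:R)) =
        expi (- (2 * pi * r%:~R * t%:R / n%:R)) :> R[i]) ->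
      `|Kentry (X n) a b k1 k2 - Kcoef Dlim a b r' (omega R k2)|
        <= ((M1 + 20 * S) / n%:R)%:C.
    move=> r'n rr'.
    have H1 := part1 n a b k1 k2; rewrite -/r in H1.
    have := riemann_Gamma W a b (omega R k2) n0 r'n.
    under eq_bigr do rewrite rr'.
    move=> H2; rewrite (mulrDl M1) (rmorphD (real_complex R)).
    by apply: le_trans (lerD H1 H2); exact: ler_distD.
  split=> hr.
  - exact: comb.
  - apply: comb => [|t]; last exact: expi_alias.
    have /andP[h1 h2] := hr.
    rewrite intr_norm rmorphB/= -pmulrn ler0_norm; last by rewrite subr_le0 ltW.
    by move: h1; lra.
  - apply: comb => [|t]; last first.
      by rewrite -(@expi_alias R n (r + n%:Z) t n0) addrK.
    have /andP[h1 h2] := hr.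
    rewrite intr_norm rmorphD/= -pmulrn ger0_norm; first by move: h2; lra.
    by move: h1; lra.
split.
- by exists M1 => n a b k1 k2; exact: part1.
- by exists (M1 + 20 * S) => n a b k1 k2; exact: part2.
exists (M1 + 20 * S) => n a b k1 k2 r.
have n0 : (0 < n)%N by apply: leq_ltn_trans (ltn_ord k1).
have [Gu _] := inv n n0.
have KJ (z : R[i]) : `|Kentry (X n) a b k1 k2 - z^*%R| = `|Kentry (X n) b a k2 k1 - z|.
  rewrite (Kentry_conj (hX n n0))// -[RHS]normcJ; congr `|_|.
  by symmetry; exact: (rmorphB conjc).
have [P1 P2 P3] := part2 n b a k2 k1.
have rE : k2%:Z - k1%:Z = - r by rewrite opprB.
rewrite rE in P1 P2 P3 *; rewrite rmorphN/= in P1 P2 P3.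
split=> hr; rewrite KJ.
- by apply: P1; rewrite normrN.
- by apply: P3; have /andP[h1 h2] := hr; rewrite !ltrN2 h1 h2.
- by apply: P2; have /andP[h1 h2] := hr; rewrite ltrNr h2 ltrNl h1.
Qed.
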